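(* Let $A$ be a Hopf $\ast$-algebra, $B$ a left $A$-comodule $\ast$-algebra, and $(\Omega^{(\bullet,\bullet)},\wedge,\partial,\overline\partial)$ an $A$-covariant factorizable complex structure on $B$ such that $\Omega^1$ is finitely generated and projective as a left $B$-module. Let $(\Omega^{(1,0)},\overline\partial_{\Omega^{(1,0)}})$ be the holomorphic structure on $\Omega^{(1,0)}$ given by $\overline\partial_{\Omega^{(1,0)}}=\theta^{(1,1)}_l\circ\overline\partial$, where $\theta^{(1,1)}_l:\Omega^{(1,1)}\to\Omega^{(0,1)}\otimes_B\Omega^{(1,0)}$ is the inverse of the wedge map. Then the Chern connection on $\Omega^{(1,0)}$ for any $A$-covariant Hermitian metric on $\Omega^{(1,0)}$ is $A$-covariant.
   Context: All algebras are unital over $\mathbb{C}$; left coactions are written $m\mapsto m_{(-1)}\otimes m_{(0)}$. ${}^{A}_{B}\mathcal{M}_B$ is the category of $B$-bimodules $M$ with a left $A$-coaction satisfying $\delta(bmc)=\delta(b)\delta(m)\delta(c)$; morphisms are $B$-bilinear, left $A$-colinear maps. A differential calculus over $B$ is a differential graded algebra $(\Omega^\bullet,\wedge,d)$ with $\Omega^0=B$, generated by $B$ and $dB$; a $\ast$-calculus has a degree-preserving conjugate-linear involution extending $\ast$ on $B$ with $(d\omega)^*=d(\omega^* )$, $(\omega\wedge\nu)^*=(-1)^{kl}\nu^*\wedge\omega^*$; it is $A$-covariant if the coaction of $B$ extends to a comodule $\ast$-algebra coaction on $\Omega^\bullet$ with every $\Omega^k\in{}^{A}_{B}\mathcal{M}_B$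 and $d$ colinear. A complex structure on a $\ast$-calculus is an $\mathbb{N}_0^2$-algebra grading $\Omega^\bullet=\bigoplus\Omega^{(p,q)}$ with $\Omega^k=\bigoplus_{p+q=k}\Omega^{(p,q)}$, $(\Omega^{(p,q)})^*=\Omega^{(q,p)}$, $d\Omega^{(p,q)}\subseteq\Omega^{(p+1,q)}\oplus\Omega^{(p,q+1)}$; $\pi^{(p,q)}$ are the projections, $\partial=\pi^{(p+1,q)}\circ d$ and $\overline\partial=\pi^{(p,q+1)}\circ d$ on $\Omega^{(p,q)}$. It is $A$-covariant if the $\ast$-calculus is $A$-covariant and all $\Omega^{(p,q)}$ are subcomodules. It is factorizable if the wedge maps $\Omega^{(0,q)}\otimes_B\Omega^{(p,0)}\to\Omega^{(p,q)}$ and $\Omega^{(p,0)}\otimes_B\Omega^{(0,q)}\to\Omega^{(p,q)}$ are invertible for all $p,q\in\mathbb{N}$. For a $B$-bimodule $M$, $\overline{M}=\{\overline m:m\in M\}$ is the conjugate vector space with $b\cdot\overline m=\overline{m b^*}$, $\overline m\cdot b=\overline{b^*m}$, coaction $\overline m\mapsto m_{(-1)}^*\otimes\overline{m_{(0)}}$. ${}_B\mathrm{Hom}(M,B)$ (left $B$-linear maps) is a $B$-bimodule via $(bf)(m)=f(mb)$, $(fb)(m)=f(m)b$, with coaction determined by $f_{(-1)}\otimes f_{(0)}(m)=S(m_{(-1)})[f(m_{(0)})]_{(-1)}\otimes[f(m_{(0)})]_{(0)}$ ($M$ finitely generated projective). A Hermitian metric on $\mathcal{E}$ is a $B$-bimodule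 isomorphism $\mathscr{H}:\overline{\mathcal{E}}\to{}_B\mathrm{Hom}(\mathcal{E},B)$ with $\langle f,\overline e\rangle^*=\langle e,\overline f\rangle$, where $\langle e,\overline f\rangle:=\mathscr{H}(\overline f)(e)$; it is $A$-covariant if $\mathscr{H}$ is $A$-colinear. A left connection on $\mathcal{E}$ is a linear map $\nabla:\mathcal{E}\to\Omega^1\otimes_B\mathcal{E}$ with $\nabla(be)=b\nabla e+db\otimes_Be$; it is $A$-covariant if it is left $A$-colinear. A left $\overline\partial$-connection is a linear map $\overline\partial_{\mathcal{E}}:\mathcal{E}\to\Omega^{(0,1)}\otimes_B\mathcal{E}$ with $\overline\partial_{\mathcal{E}}(be)=b\overline\partial_{\mathcal{E}}e+\overline\partial b\otimes_Be$; $(\mathcal{E},\overline\partial_{\mathcal{E}})$ is a holomorphic $B$-bimodule if $(\overline\partial\otimes_B\mathrm{id}-\mathrm{id}\wedge\overline\partial_{\mathcal{E}})\overline\partial_{\mathcal{E}}=0$. $\nabla$ is compatible with $\mathscr{H}$ if $d\langle e,\overline f\rangle=(\mathrm{id}\otimes_B\langle\ ,\ \rangle)(\nabla e\otimes_B\overline f)+(\langle\ ,\ \rangle\otimes_B\mathrm{id})(e\otimes_B\widetilde\nabla\overline f)$ for all $e,f\in\mathcal{E}$, where $\widetilde\nabla(\overline f)=\sum_i\overline{x_i}\otimes_B\omega_i^*$ if $\nabla f=\sum_i\omega_i\otimes_Bx_i$. For $\mathcal{E}$ finitely generated projective as a left $B$-module, the Chern connection of $(\mathcal{E},\overline\partial_{\mathcal{E}},\mathscr{H})$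 is the unique left connection on $\mathcal{E}$ (it exists by Beggs--Majid) that is compatible with $\mathscr{H}$ and satisfies $(\pi^{(0,1)}\otimes_B\mathrm{id})\nabla=\overline\partial_{\mathcal{E}}$. *)

(* Defs.v *)
From HB Require Import structures.
From mathcomp Require Import all_boot all_order all_algebra.
From mathcomp Require Import boolp functions reals complex.

Set Implicit Arguments.
Unset Strict Implicit.
Unset Printing Implicit Defensive.

Import Order.TTheory GRing.Theory Num.Theory.

Local Open Scope ring_scope.
Local Open Scope quotient_scope.

(* Balanced tensor product of a right and a left action of R: formal sums of  *)
(* pairs modulo the congruence generated by the bilinearity and balancing     *)
(* relations (negatives are recovered as (- m, n)).                           *)
Section Tensor.
Variables (R : Type) (M N : zmodType) (ra : M -> R -> M) (la : R -> N -> N).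

Inductive tens_eq : seq (M * N) -> seq (M * N) -> Prop :=
| TensRefl s : tens_eq s s
| TensSym s t : tens_eq s t -> tens_eq t s
| TensTrans s t u : tens_eq s t -> tens_eq t u -> tens_eq s u
| TensCat s s' t t' :
    tens_eq s s' -> tens_eq t t' -> tens_eq (s ++ t) (s' ++ t')
| TensCatC s t : tens_eq (s ++ t) (t ++ s)
| Tens0 n : tens_eq [:: (0, n)] [::]
| TensDl m m' n : tens_eq [:: (m + m', n)] [:: (m, n); (m', n)]
| TensDr m n n' : tens_eq [:: (m, n + n')] [:: (m, n); (m, n')]
| TensBal m r n : tens_eq [:: (ra m r, n)] [:: (m, la r n)].

Definition tens_rel : rel (seq (M * N)) := fun s t => `[< tens_eq s t >].

Fact tens_rel_refl : reflexive tens_rel.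
Proof. by move=> s; apply/asboolP; apply: TensRefl. Qed.
Fact tens_rel_sym : symmetric tens_rel.
Proof. by move=> s t; apply/asboolP/asboolP; apply: TensSym. Qed.
Fact tens_rel_trans : transitive tens_rel.
Proof.
by move=> s t u /asboolP h1 /asboolP h2; apply/asboolP; apply: TensTrans h1 h2.
Qed.

Canonical tens_equiv :=
  EquivRel tens_rel tens_rel_refl tens_rel_sym tens_rel_trans.

Definition tens := {eq_quot tens_equiv}.
HB.instance Definition _ := Choice.on tens.

Definition tens_of (s : seq (M * N)) : tens := \pi_({eq_quot tens_equiv}) s.
Definition tens_repr (x : tens) : seq (M * N) := repr x.

Lemma tens_reprK x : tens_of (tens_repr x) = x.
Proof. exact: reprK. Qed.

Lemma tens_ofP s t : tens_of s = tens_of t <-> tens_eq s t.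
Proof.
split=> [/eqP|h]; last by apply/eqP; rewrite eqmodE; apply/asboolP.
by rewrite eqmodE => /asboolP.
Qed.

Lemma tens_repr_of s : tens_eq (tens_repr (tens_of s)) s.
Proof. by apply/tens_ofP; rewrite tens_reprK. Qed.

Definition tens_add (x y : tens) := tens_of (tens_repr x ++ tens_repr y).
Definition tens_opp_seq (s : seq (M * N)) := [seq (- p.1, p.2) | p <- s].
Definition tens_opp (x : tens) := tens_of (tens_opp_seq (tens_repr x)).

Lemma tens_addE s t : tens_add (tens_of s) (tens_of t) = tens_of (s ++ t).
Proof. by apply/tens_ofP; apply: TensCat; apply: tens_repr_of. Qed.

Fact tens_addA : associative tens_add.
Proof.
move=> x y z; rewrite -(tens_reprK x) -(tens_reprK y) -(tens_reprK z).
by rewrite !tens_addE catA.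
Qed.
Fact tens_addC : commutative tens_add.
Proof.
by move=> x y; apply/tens_ofP; apply: TensCatC.
Qed.
Fact tens_add0 : left_id (tens_of [::]) tens_add.
Proof. by move=> x; rewrite -(tens_reprK x) tens_addE. Qed.
Fact tens_addN : left_inverse (tens_of [::]) tens_opp tens_add.
Proof.
move=> x; rewrite /tens_opp -{2}(tens_reprK x) tens_addE.
apply/tens_ofP; elim: (tens_repr x) => [|[m n] s IH]; first exact: TensRefl.
have h : tens_eq (tens_opp_seq s ++ ([:: (m, n)] ++ s))
                 ([:: (m, n)] ++ (tens_opp_seq s ++ s)).
  rewrite !catA; apply: TensCat (TensRefl s); exact: TensCatC.
apply: TensTrans (TensCat (TensRefl [:: (- m, n)]) h) _; rewrite catA.
rewrite -[X in tens_eq _ X]/([::] ++ [::]); apply: TensCat => //.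
by apply: TensTrans (TensSym (TensDl _ _ _)) _; rewrite addNr; apply: Tens0.
Qed.

HB.instance Definition _ :=
  GRing.isZmodule.Build tens tens_addA tens_addC tens_add0 tens_addN.

Definition tpure (m : M) (n : N) : tens := tens_of [:: (m, n)].

(* Value at a tensor of the additive map induced by f; meaningful when f is   *)
(* balanced, see tliftE and tliftD.                                           *)
Definition tlift (V : zmodType) (f : M -> N -> V) (x : tens) : V :=
  \sum_(p <- tens_repr x) f p.1 p.2.

Definition balanced (V : zmodType) (f : M -> N -> V) : Prop :=
  [/\ forall m m' n, f (m + m') n = f m n + f m' n,
      forall m n n', f m (n + n') = f m n + f m n'
    & forall m r n, f (ra m r) n = f m (la r n)].

Lemma tens_ofD s t : tens_of (s ++ t) = tens_of s + tens_of t.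
Proof. by rewrite -tens_addE. Qed.

Lemma tens_ind (P : tens -> Prop) :
  P 0 -> (forall m n, P (tpure m n)) ->
  (forall x y, P x -> P y -> P (x + y)) -> forall x, P x.
Proof.
move=> P0 Pp PD x; rewrite -(tens_reprK x).
elim: (tens_repr x) => [//|[m n] s IH].
by rewrite -cat1s tens_ofD; apply: PD IH; apply: Pp.
Qed.

Lemma tpure_balanced : balanced tpure.
Proof.
split=> *; rewrite -?tens_ofD; apply/tens_ofP.
- exact: TensDl.
- exact: TensDr.
- exact: TensBal.
Qed.

Section Lift.
Variables (V : zmodType) (f : M -> N -> V) (fb : balanced f).

Lemma balanced_sum s t :
  tens_eq s t -> \sum_(p <- s) f p.1 p.2 = \sum_(p <- t) f p.1 p.2.
Proof.
have [fDl fDr fr] := fb.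
elim=> //= {s t}.
- by move=> s t u _ -> _ ->.
- by move=> s s' t t' _ e1 _ e2; rewrite !big_cat e1 e2.
- by move=> s t; rewrite !big_cat /= addrC.
- move=> n; rewrite big_seq1 big_nil /=; apply: (@addrI _ (f 0 n)).
  by rewrite -fDl !addr0.
- by move=> m m' n; rewrite !big_cons big_nil /= !addr0.
- by move=> m n n'; rewrite !big_cons big_nil /= !addr0.
- by move=> m r n; rewrite !big_cons big_nil /= !addr0.
Qed.

Lemma tlift_of s : tlift f (tens_of s) = \sum_(p <- s) f p.1 p.2.
Proof. exact: balanced_sum (tens_repr_of s). Qed.

Lemma tliftE m n : tlift f (tpure m n) = f m n.
Proof. by rewrite tlift_of big_seq1. Qed.

Lemma tliftD : {morph tlift f : x y / x + y}.
Proof.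
move=> x y; rewrite -(tens_reprK x) -(tens_reprK y) -tens_ofD !tlift_of.
by rewrite big_cat.
Qed.

Lemma tlift0 : tlift f 0 = 0.
Proof. by apply: (@addrI _ (tlift f 0)); rewrite -tliftD !addr0. Qed.

End Lift.

Lemma tens_ext (V : zmodType) (g h : tens -> V) :
  {morph g : x y / x + y} -> {morph h : x y / x + y} ->
  (forall m n, g (tpure m n) = h (tpure m n)) -> g =1 h.
Proof.
move=> gD hD e; apply: tens_ind => // [|x y ex ey]; last by rewrite gD hD ex ey.
have g0 : g 0 = 0 by apply: (@addrI _ (g 0)); rewrite -gD !addr0.
by rewrite g0; apply: (@addrI _ (h 0)); rewrite -hD !addr0.
Qed.

End Tensor.

Section ComplexTensor.
Variable C : numClosedFieldType.

Definition ctens (M N : lmodType C) : Type :=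
  tens (fun (m : M) (c : C) => c *: m) (fun (c : C) (n : N) => c *: n).

HB.instance Definition _ (M N : lmodType C) := GRing.Zmodule.on (ctens M N).

Definition cpure (M N : lmodType C) (m : M) (n : N) : ctens M N := tpure _ _ m n.

Lemma cpure_balanced (M N : lmodType C) :
  balanced (fun (m : M) (c : C) => c *: m) (fun (c : C) (n : N) => c *: n)
    (@cpure M N).
Proof. exact: tpure_balanced. Qed.

Section Scale.
Variables M N : lmodType C.

Definition ctens_scale (c : C) (x : ctens M N) : ctens M N :=
  tlift (fun m n => cpure (c *: m) n) x.

Fact ctens_scale_balanced c : balanced (fun (m : M) (c : C) => c *: m)
  (fun (c : C) (n : N) => c *: n) (fun m n => cpure (c *: m) n).
Proof.
have [hl hr hb] := cpure_balanced M N.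
by split=> *; rewrite ?scalerDr ?hl ?hr // -hb !scalerA mulrC.
Qed.

Lemma ctens_scaleE c m n : ctens_scale c (cpure m n) = cpure (c *: m) n.
Proof. exact: tliftE (ctens_scale_balanced c) m n. Qed.

Fact ctens_scaleDr : right_distributive ctens_scale +%R.
Proof. by move=> c; apply: tliftD; apply: ctens_scale_balanced. Qed.

Fact ctens_scaleA a b x : ctens_scale a (ctens_scale b x) = ctens_scale (a * b) x.
Proof.
move: x; apply: tens_ext => [x y|x y|m n] /=; rewrite ?ctens_scaleDr //.
by rewrite -/(cpure m n) !ctens_scaleE scalerA.
Qed.

Fact ctens_scale1 : left_id 1 ctens_scale.
Proof.
apply: tens_ext => [x y|x y|m n] /=; rewrite ?ctens_scaleDr //.
by rewrite -/(cpure m n) !ctens_scaleE scale1r.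
Qed.

Fact ctens_scaleDl x : {morph ctens_scale^~ x : a b / a + b}.
Proof.
move=> a b; move: x; apply: tens_ext => [x y|x y|m n] /=.
- exact: ctens_scaleDr.
- by rewrite !ctens_scaleDr addrACA.
- have [hl _ _] := cpure_balanced M N.
  by rewrite -/(cpure m n) !ctens_scaleE scalerDl hl.
Qed.

HB.instance Definition _ := GRing.Zmodule_isLmodule.Build C (ctens M N)
  ctens_scaleA ctens_scale1 ctens_scaleDr ctens_scaleDl.

End Scale.

(* Also used with f and g both conjugate-linear.                              *)
Definition cmap (M N M' N' : lmodType C) (f : M -> M') (g : N -> N')
  (x : ctens M N) : ctens M' N' := tlift (fun m n => cpure (f m) (g n)) x.

Definition cassoc (M N P : lmodType C) (x : ctens (ctens M N) P) :
    ctens M (ctens N P) :=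
  tlift (fun t p => tlift (fun m n => cpure m (cpure n p)) t) x.

(* (a (x) m) . (a' (x) n) = a a' (x) op m n *)
Definition cmul (A : algType C) (M N P : lmodType C) (op : M -> N -> P)
    (x : ctens A M) (y : ctens A N) : ctens A P :=
  tlift (fun a m => tlift (fun a' n => cpure (a * a') (op m n)) y) x.

End ComplexTensor.

HB.mixin Record isStarAlgebra (C : numClosedFieldType) A
    of GRing.Algebra C A := {
  star : A -> A;
  starD : forall x y, star (x + y) = star x + star y;
  starZ : forall (c : C) x, star (c *: x) = c^* *: star x;
  starM : forall x y, star (x * y) = star y * star x;
  starK : forall x, star (star x) = x
}.

#[short(type="starAlgType")]
HB.structure Definition StarAlgebra (C : numClosedFieldType) :=
  { A of isStarAlgebra C A & GRing.Algebra C A }.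

HB.mixin Record isHopfStarAlgebra (C : numClosedFieldType) A
    of StarAlgebra C A := {
  comul : A -> ctens A A;
  counit : A -> C;
  antipode : A -> A;
  comul_linear : linear comul;
  counit_linear : linear (counit : A -> C^o);
  antipode_linear : linear antipode;
  comulA : forall a,
    cassoc (cmap comul idfun (comul a)) = cmap idfun comul (comul a);
  comul_counitl : forall a, tlift (fun x y => counit x *: y) (comul a) = a;
  comul_counitr : forall a, tlift (fun x y => counit y *: x) (comul a) = a;
  comul1 : comul 1 = cpure 1 1;
  comulM : forall a b, comul (a * b) = cmul *%R (comul a) (comul b);
  counit1 : counit 1 = 1;
  counitM : forall a b, counit (a * b) = counit a * counit b;
  antipodel : forall a,
    tlift (fun x y => antipode x * y) (comul a) = (counit a)%:A;
  antipoder : forall a,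
    tlift (fun x y => x * antipode y) (comul a) = (counit a)%:A;
  comul_star : forall a, comul (star a) = cmap star star (comul a);
  counit_star : forall a, counit (star a) = (counit a)^*
}.

#[short(type="hopfStarAlgType")]
HB.structure Definition HopfStarAlgebra (C : numClosedFieldType) :=
  { A of isHopfStarAlgebra C A & StarAlgebra C A }.

Definition left_coaction (C : numClosedFieldType) (A : hopfStarAlgType C)
    (M : lmodType C) (delta : M -> ctens A M) : Prop :=
  [/\ linear delta,
      forall m, cassoc (cmap comul idfun (delta m)) = cmap idfun delta (delta m)
    & forall m, tlift (fun a x => counit a *: x) (delta m) = m].

HB.mixin Record isComoduleStarAlgebra (C : numClosedFieldType)
    (A : hopfStarAlgType C) B of StarAlgebra C B := {
  coact : B -> ctens A B;
  coactP : left_coaction coact;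
  coact1 : coact 1 = cpure 1 1;
  coactM : forall b c, coact (b * c) = cmul *%R (coact b) (coact c);
  coact_star : forall b, coact (star b) = cmap star star (coact b)
}.

#[short(type="comoduleStarAlgType")]
HB.structure Definition ComoduleStarAlgebra (C : numClosedFieldType)
    (A : hopfStarAlgType C) :=
  { B of isComoduleStarAlgebra C A B & StarAlgebra C B }.

HB.mixin Record isBimodule (C : numClosedFieldType) (B : algType C) M
    of GRing.Lmodule C M := {
  lact : B -> M -> M;
  ract : M -> B -> M;
  lactDl : forall b c m, lact (b + c) m = lact b m + lact c m;
  lactDr : forall b m n, lact b (m + n) = lact b m + lact b n;
  lactA : forall b c m, lact b (lact c m) = lact (b * c) m;
  lact1 : forall m, lact 1 m = m;
  lactZ : forall (k : C) b m, lact (k *: b) m = k *: lact b m;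
  ractDl : forall m n b, ract (m + n) b = ract m b + ract n b;
  ractDr : forall m b c, ract m (b + c) = ract m b + ract m c;
  ractA : forall m b c, ract (ract m b) c = ract m (b * c);
  ract1 : forall m, ract m 1 = m;
  ractZ : forall (k : C) m b, ract m (k *: b) = k *: ract m b;
  lractA : forall b m c, ract (lact b m) c = lact b (ract m c)
}.

#[short(type="bimodType")]
HB.structure Definition Bimodule (C : numClosedFieldType) (B : algType C) :=
  { M of isBimodule C B M & GRing.Lmodule C M }.

Section BimoduleTheory.
Variables (C : numClosedFieldType) (B : algType C) (M : bimodType B).

Lemma lactZr (k : C) (b : B) (m : M) : lact b (k *: m) = k *: lact b m.
Proof. by rewrite -[m in LHS](lact1 (s:=M)) -lactZ lactA -scalerAr mulr1 lactZ. Qed.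

Lemma ractZl (k : C) (b : B) (m : M) : ract (k *: m) b = k *: ract m b.
Proof. by rewrite -[m in LHS](ract1 (s:=M)) -ractZ ractA -scalerAl mul1r ractZ. Qed.

(* The underlying left B-module of M. *)
Definition left_module : Type := M.
HB.instance Definition _ := GRing.Zmodule.on left_module.

Fact left_moduleDl (m : left_module) : {morph (fun b => lact b (m : M)) : b c / b + c}.
Proof. by move=> b c; apply: lactDl. Qed.

HB.instance Definition _ := GRing.Zmodule_isLmodule.Build B left_module
  (@lactA C B M) (@lact1 C B M) (@lactDr C B M) left_moduleDl.

Definition finitely_generated : Prop :=
  exists n (e : 'I_n -> left_module),
    forall m, exists b : 'I_n -> B, m = \sum_i b i *: e i.

Definition projective : Prop :=
  forall (P Q : lmodType B) (g : {linear P -> Q}) (f : {linear left_module -> Q}),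
    (forall q, exists p, g p = q) ->
    exists h : {linear left_module -> P}, forall m, g (h m) = f m.

End BimoduleTheory.

Section BalancedTensor.
Variables (C : numClosedFieldType) (B : algType C) (M N : bimodType B).

Definition btens : Type := tens (@ract C B M) (@lact C B N).
HB.instance Definition _ := GRing.Zmodule.on btens.

Definition bpure (m : M) (n : N) : btens := tpure _ _ m n.

Lemma bpure_balanced : balanced (@ract C B M) (@lact C B N) bpure.
Proof. exact: tpure_balanced. Qed.

Definition btens_scale (k : C) (x : btens) : btens :=
  tlift (fun m n => bpure (k *: m) n) x.
Definition btens_lact (b : B) (x : btens) : btens :=
  tlift (fun m n => bpure (lact b m) n) x.
Definition btens_ract (x : btens) (b : B) : btens :=
  tlift (fun m n => bpure m (ract n b)) x.

Fact btens_scale_balanced k :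
  balanced (@ract C B M) (@lact C B N) (fun m n => bpure (k *: m) n).
Proof.
have [hl hr hb] := bpure_balanced.
by split=> *; rewrite ?scalerDr ?hl ?hr // -ractZl hb.
Qed.
Fact btens_lact_balanced b :
  balanced (@ract C B M) (@lact C B N) (fun m n => bpure (lact b m) n).
Proof.
have [hl hr hb] := bpure_balanced.
by split=> *; rewrite ?lactDr ?hl ?hr // -lractA hb.
Qed.
Fact btens_ract_balanced b :
  balanced (@ract C B M) (@lact C B N) (fun m n => bpure m (ract n b)).
Proof.
have [hl hr hb] := bpure_balanced.
by split=> *; rewrite ?ractDl ?hl ?hr // lractA hb.
Qed.

Lemma btens_scaleE k m n : btens_scale k (bpure m n) = bpure (k *: m) n.
Proof. exact: tliftE (btens_scale_balanced k) m n. Qed.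
Lemma btens_lactE b m n : btens_lact b (bpure m n) = bpure (lact b m) n.
Proof. exact: tliftE (btens_lact_balanced b) m n. Qed.
Lemma btens_ractE b m n : btens_ract (bpure m n) b = bpure m (ract n b).
Proof. exact: tliftE (btens_ract_balanced b) m n. Qed.

Fact btens_scaleDr : right_distributive btens_scale +%R.
Proof. by move=> k; apply: tliftD; apply: btens_scale_balanced. Qed.
Fact btens_lactDr b (x y : btens) :
  btens_lact b (x + y) = btens_lact b x + btens_lact b y.
Proof. by apply: tliftD; apply: btens_lact_balanced. Qed.
Fact btens_ractDl (x y : btens) b :
  btens_ract (x + y) b = btens_ract x b + btens_ract y b.
Proof. by apply: (tliftD (btens_ract_balanced b)). Qed.

Let bE := (btens_scaleE, btens_lactE, btens_ractE).
Let bD := (btens_scaleDr, btens_lactDr, btens_ractDl).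

Fact btens_scaleA a b x : btens_scale a (btens_scale b x) = btens_scale (a * b) x.
Proof.
move: x; apply: tens_ext => [x y|x y|m n] /=; rewrite ?bD //.
by rewrite -/(bpure m n) !bE scalerA.
Qed.
Fact btens_scale1 : left_id 1 btens_scale.
Proof.
apply: tens_ext => [x y|x y|m n] /=; rewrite ?bD //.
by rewrite -/(bpure m n) !bE scale1r.
Qed.
Fact btens_scaleDl x : {morph btens_scale^~ x : a b / a + b}.
Proof.
move=> a b; move: x; apply: tens_ext => [x y|x y|m n] /=; rewrite ?bD //.
  by rewrite addrACA.
have [hl _ _] := bpure_balanced.
by rewrite -/(bpure m n) !bE scalerDl hl.
Qed.

HB.instance Definition _ := GRing.Zmodule_isLmodule.Build C btens
  btens_scaleA btens_scale1 btens_scaleDr btens_scaleDl.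

Fact btens_lactDl b c x : btens_lact (b + c) x = btens_lact b x + btens_lact c x.
Proof.
move: x; apply: tens_ext => [x y|x y|m n] /=; rewrite ?bD //.
  by rewrite addrACA.
have [hl _ _] := bpure_balanced.
by rewrite -/(bpure m n) !bE lactDl hl.
Qed.
Fact btens_ractDr x b c : btens_ract x (b + c) = btens_ract x b + btens_ract x c.
Proof.
move: x; apply: tens_ext => [x y|x y|m n] /=; rewrite ?bD //.
  by rewrite addrACA.
have [_ hr _] := bpure_balanced.
by rewrite -/(bpure m n) !bE ractDr hr.
Qed.
Fact btens_lactA b c x : btens_lact b (btens_lact c x) = btens_lact (b * c) x.
Proof.
move: x; apply: tens_ext => [x y|x y|m n] /=; rewrite ?bD //.
by rewrite -/(bpure m n) !bE lactA.
Qed.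
Fact btens_ractA x b c : btens_ract (btens_ract x b) c = btens_ract x (b * c).
Proof.
move: x; apply: tens_ext => [x y|x y|m n] /=; rewrite ?bD //.
by rewrite -/(bpure m n) !bE ractA.
Qed.
Fact btens_lact1 x : btens_lact 1 x = x.
Proof.
move: x; apply: tens_ext => [x y|x y|m n] /=; rewrite ?bD //.
by rewrite -/(bpure m n) !bE lact1.
Qed.
Fact btens_ract1 x : btens_ract x 1 = x.
Proof.
move: x; apply: tens_ext => [x y|x y|m n] /=; rewrite ?bD //.
by rewrite -/(bpure m n) !bE ract1.
Qed.
Fact btens_lactZ (k : C) b x : btens_lact (k *: b) x = btens_scale k (btens_lact b x).
Proof.
move: x; apply: tens_ext => [x y|x y|m n] /=; rewrite ?bD //.
by rewrite -/(bpure m n) !bE lactZ.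
Qed.
Fact btens_ractZ (k : C) x b : btens_ract x (k *: b) = btens_scale k (btens_ract x b).
Proof.
move: x; apply: tens_ext => [x y|x y|m n] /=; rewrite ?bD //.
have [_ _ hb] := bpure_balanced; rewrite -/(bpure m n) !bE ractZ.
by rewrite -[X in k *: X](lact1 (s:=N)) -lactZ -hb ractZ ract1.
Qed.
Fact btens_lractA b x c :
  btens_ract (btens_lact b x) c = btens_lact b (btens_ract x c).
Proof.
move: x; apply: tens_ext => [x y|x y|m n] /=; rewrite ?bD //.
by rewrite -/(bpure m n) !bE.
Qed.

HB.instance Definition _ := isBimodule.Build C B btens
  btens_lactDl btens_lactDr btens_lactA btens_lact1 btens_lactZ
  btens_ractDl btens_ractDr btens_ractA btens_ract1 btens_ractZ btens_lractA.

End BalancedTensor.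

Definition bmap (C : numClosedFieldType) (B : algType C)
    (M N M' N' : bimodType B) (f : M -> M') (g : N -> N')
    (x : btens M N) : btens M' N' :=
  tlift (fun m n => bpure (f m) (g n)) x.

(* m (x) n |-> m_(-1) n_(-1) (x) (m_(0) (x) n_(0)) *)
Definition btens_coact (C : numClosedFieldType) (A : hopfStarAlgType C)
    (B : algType C) (M N : bimodType B) (deltaM : M -> ctens A M)
    (deltaN : N -> ctens A N) (x : btens M N) : ctens A (btens M N) :=
  tlift (fun m n => cmul (@bpure _ _ M N) (deltaM m) (deltaN n)) x.

(* M with the coaction delta is an object of the category of A-covariant      *)
(* B-bimodules.                                                               *)
Definition covariant_bimodule (C : numClosedFieldType) (A : hopfStarAlgType C)
    (B : comoduleStarAlgType A) (M : bimodType B) (delta : M -> ctens A M) :=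
  left_coaction delta /\
  forall b m c, delta (ract (lact b m) c) =
    cmul (@ract _ _ M) (cmul (@lact _ _ M) (coact b) (delta m)) (coact c).

Definition colinear (C : numClosedFieldType) (A : hopfStarAlgType C)
    (M N : lmodType C) (deltaM : M -> ctens A M) (deltaN : N -> ctens A N)
    (f : M -> N) : Prop :=
  forall m, deltaN (f m) = cmap idfun f (deltaM m).

Section Conjugate.
Variables (C : numClosedFieldType) (B : starAlgType C) (M : bimodType B).

Definition conjugate : Type := M.
HB.instance Definition _ := GRing.Zmodule.on conjugate.

Definition cj (m : M) : conjugate := m.
Definition uncj (x : conjugate) : M := x.

Definition cj_scale (k : C) (x : conjugate) : conjugate := cj (k^* *: uncj x).
Definition cj_lact (b : B) (x : conjugate) : conjugate :=
  cj (ract (uncj x) (star b)).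
Definition cj_ract (x : conjugate) (b : B) : conjugate :=
  cj (lact (star b) (uncj x)).

Fact cj_scaleA a b x : cj_scale a (cj_scale b x) = cj_scale (a * b) x.
Proof. by rewrite /cj_scale scalerA rmorphM. Qed.
Fact cj_scale1 : left_id 1 cj_scale.
Proof. by move=> x; rewrite /cj_scale rmorph1 scale1r. Qed.
Fact cj_scaleDr : right_distributive cj_scale +%R.
Proof. by move=> a x y; apply: scalerDr. Qed.
Fact cj_scaleDl x : {morph cj_scale^~ x : a b / a + b}.
Proof. by move=> a b; rewrite /cj_scale rmorphD scalerDl. Qed.

HB.instance Definition _ := GRing.Zmodule_isLmodule.Build C conjugate
  cj_scaleA cj_scale1 cj_scaleDr cj_scaleDl.

Lemma star1 : star 1 = 1 :> B.
Proof. by have := starM (1 : B) (star 1); rewrite !mul1r !starK mul1r. Qed.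

Fact cj_lactDl b c x : cj_lact (b + c) x = cj_lact b x + cj_lact c x.
Proof. by rewrite /cj_lact starD ractDr. Qed.
Fact cj_lactDr b x y : cj_lact b (x + y) = cj_lact b x + cj_lact b y.
Proof. exact: ractDl. Qed.
Fact cj_lactA b c x : cj_lact b (cj_lact c x) = cj_lact (b * c) x.
Proof. by rewrite /cj_lact ractA starM. Qed.
Fact cj_lact1 x : cj_lact 1 x = x.
Proof. by rewrite /cj_lact star1 ract1. Qed.
Fact cj_lactZ (k : C) b x : cj_lact (k *: b) x = k *: cj_lact b x.
Proof. by rewrite /cj_lact starZ ractZ. Qed.
Fact cj_ractDl x y b : cj_ract (x + y) b = cj_ract x b + cj_ract y b.
Proof. exact: lactDr. Qed.
Fact cj_ractDr x b c : cj_ract x (b + c) = cj_ract x b + cj_ract x c.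
Proof. by rewrite /cj_ract starD lactDl. Qed.
Fact cj_ractA x b c : cj_ract (cj_ract x b) c = cj_ract x (b * c).
Proof. by rewrite /cj_ract lactA starM. Qed.
Fact cj_ract1 x : cj_ract x 1 = x.
Proof. by rewrite /cj_ract star1 lact1. Qed.
Fact cj_ractZ (k : C) x b : cj_ract x (k *: b) = k *: cj_ract x b.
Proof. by rewrite /cj_ract starZ lactZ. Qed.
Fact cj_lractA b x c : cj_ract (cj_lact b x) c = cj_lact b (cj_ract x c).
Proof. by rewrite /cj_ract /cj_lact lractA. Qed.

HB.instance Definition _ := isBimodule.Build C B conjugate
  cj_lactDl cj_lactDr cj_lactA cj_lact1 cj_lactZ
  cj_ractDl cj_ractDr cj_ractA cj_ract1 cj_ractZ cj_lractA.

Definition conjugate_coact (A : hopfStarAlgType C) (delta : M -> ctens A M)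
    (x : conjugate) : ctens A conjugate :=
  cmap star cj (delta (uncj x)).

End Conjugate.

Section LeftHom.
Variables (C : numClosedFieldType) (B : algType C) (M : bimodType B).

Definition left_linear_pred : {pred M -> B} := fun f =>
  `[< forall b m n, f (lact b m + n) = b * f m + f n >].

Fact left_linear_submod_closed : submod_closed left_linear_pred.
Proof.
split=> [|k f g /asboolP fl /asboolP gl]; apply/asboolP => b m n.
  by rewrite /= mulr0 addr0.
rewrite !fctE fl gl scalerDr mulrDr -scalerAr !addrA; congr (_ + _).
by rewrite addrAC.
Qed.
HB.instance Definition _ := GRing.isSubmodClosed.Build C (M -> B)
  left_linear_pred left_linear_submod_closed.

(* Left B-linear maps M -> B. *)
Record leftHom := LeftHom { lhom :> M -> B; _ : lhom \in left_linear_pred }.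
HB.instance Definition _ := [isSub for lhom].
HB.instance Definition _ := [Choice of leftHom by <:].
HB.instance Definition _ := [SubChoice_isSubLmodule of leftHom by <:].

Lemma lhomP (f : leftHom) b m n : f (lact b m + n) = b * f m + f n.
Proof. by case: f => f /= /asboolP. Qed.

Fact lhom_lact_subproof b (f : leftHom) :
  (fun m => f (ract m b)) \in left_linear_pred.
Proof. by apply/asboolP => c m n; rewrite ractDl lractA lhomP. Qed.
Fact lhom_ract_subproof (f : leftHom) b :
  (fun m => f m * b) \in left_linear_pred.
Proof. by apply/asboolP => c m n; rewrite lhomP mulrDl mulrA. Qed.

Definition lhom_lact b f := LeftHom (lhom_lact_subproof b f).
Definition lhom_ract f b := LeftHom (lhom_ract_subproof f b).

Lemma lhomD (f : leftHom) m n : f (m + n) = f m + f n.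
Proof. by rewrite -[m in LHS](lact1 (s:=M)) lhomP mul1r. Qed.
Lemma lhom0 (f : leftHom) : f 0 = 0.
Proof. by apply: (@addrI _ (f 0)); rewrite -lhomD !addr0. Qed.
Lemma lhomZ (f : leftHom) k m : f (k *: m) = k *: f m.
Proof.
rewrite -[m in LHS](lact1 (s:=M)) -lactZ -[X in f X]addr0 lhomP lhom0 addr0.
by rewrite -scalerAl mul1r.
Qed.

Fact lhom_lactDl b c f : lhom_lact (b + c) f = lhom_lact b f + lhom_lact c f.
Proof. by apply: val_inj; apply/funext => m; rewrite /= ractDr lhomD. Qed.
Fact lhom_lactDr b f g : lhom_lact b (f + g) = lhom_lact b f + lhom_lact b g.
Proof. by apply: val_inj. Qed.
Fact lhom_lactA b c f : lhom_lact b (lhom_lact c f) = lhom_lact (b * c) f.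
Proof. by apply: val_inj; apply/funext => m; rewrite /= ractA. Qed.
Fact lhom_lact1 f : lhom_lact 1 f = f.
Proof. by apply: val_inj; apply/funext => m; rewrite /= ract1. Qed.
Fact lhom_lactZ (k : C) b f : lhom_lact (k *: b) f = k *: lhom_lact b f.
Proof. by apply: val_inj; apply/funext => m; rewrite /= ractZ lhomZ. Qed.
Fact lhom_ractDl f g b : lhom_ract (f + g) b = lhom_ract f b + lhom_ract g b.
Proof. by apply: val_inj; apply/funext => m; rewrite /= mulrDl. Qed.
Fact lhom_ractDr f b c : lhom_ract f (b + c) = lhom_ract f b + lhom_ract f c.
Proof. by apply: val_inj; apply/funext => m; rewrite /= mulrDr. Qed.
Fact lhom_ractA f b c : lhom_ract (lhom_ract f b) c = lhom_ract f (b * c).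
Proof. by apply: val_inj; apply/funext => m; rewrite /= mulrA. Qed.
Fact lhom_ract1 f : lhom_ract f 1 = f.
Proof. by apply: val_inj; apply/funext => m; rewrite /= mulr1. Qed.
Fact lhom_ractZ (k : C) f b : lhom_ract f (k *: b) = k *: lhom_ract f b.
Proof. by apply: val_inj; apply/funext => m; rewrite /= -scalerAr. Qed.
Fact lhom_lractA b f c : lhom_ract (lhom_lact b f) c = lhom_lact b (lhom_ract f c).
Proof. exact: val_inj. Qed.

HB.instance Definition _ := isBimodule.Build C B leftHom
  lhom_lactDl lhom_lactDr lhom_lactA lhom_lact1 lhom_lactZ
  lhom_ractDl lhom_ractDr lhom_ractA lhom_ract1 lhom_ractZ lhom_lractA.

End LeftHom.
(* A direct sum decomposition of V indexed by I, given by its projections.    *)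
Record grading (C : numClosedFieldType) (V : lmodType C) (I : eqType) := Grading {
  proj : I -> {linear V -> V};
  projK : forall i x, proj i (proj i x) = proj i x;
  proj_orth : forall i j x, i != j -> proj i (proj j x) = 0;
  proj_sum : forall x, exists s : seq I, uniq s /\ x = \sum_(i <- s) proj i x
}.

Definition homogeneous (C : numClosedFieldType) (V : lmodType C) (I : eqType)
    (G : grading V I) (i : I) : {pred V} := fun x => proj G i x == x.

Section Parts.
Variables (C : numClosedFieldType) (V : lmodType C) (I : eqType).
Variables (G : grading V I) (i : I).

Fact homogeneous_submod_closed : submod_closed (homogeneous G i).
Proof.
split=> [|k x y /eqP hx /eqP hy]; apply/eqP; first exact: linear0.
by rewrite linearP hx hy.
Qed.
HB.instance Definition _ := GRing.isSubmodClosed.Build C V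
  (homogeneous G i) homogeneous_submod_closed.

Record part := Part { part_val :> V; _ : part_val \in homogeneous G i }.
HB.instance Definition _ := [isSub for part_val].
HB.instance Definition _ := [Choice of part by <:].
HB.instance Definition _ := [SubChoice_isSubLmodule of part by <:].

Fact proj_homogeneous x : proj G i x \in homogeneous G i.
Proof. by apply/eqP; apply: projK. Qed.

Definition to_part (x : V) : part := Part (proj_homogeneous x).

Lemma part_homogeneous (x : part) : (x : V) \in homogeneous G i.
Proof. by case: x. Qed.

Lemma to_part_val (x : part) : to_part x = x.
Proof. by apply: val_inj; apply/eqP/(part_homogeneous x). Qed.

(* For a subcomodule V_i of V, the corestriction of the coaction of V.        *)
Definition part_coact (A : hopfStarAlgType C) (delta : V -> ctens A V)
    (x : part) : ctens A part :=
  cmap idfun to_part (delta x).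

Definition subcomodule (A : hopfStarAlgType C) (delta : V -> ctens A V) : Prop :=
  forall x : part, exists t : ctens A part, delta x = cmap idfun part_val t.

End Parts.

Lemma proj_neq (C : numClosedFieldType) (V : lmodType C) (I : eqType)
    (G : grading V I) i j x :
  x \in homogeneous G j -> i != j -> proj G i x = 0.
Proof. by move=> /eqP <- ne; apply: proj_orth. Qed.

(* The part of G of index i, as a B-bimodule through f : B -> Om.             *)
Section Piece.
Variables (C : numClosedFieldType) (B Om : algType C) (f : {lrmorphism B -> Om}).
Variables (I : eqType) (G : grading Om I) (i : I).

Definition bimodule_part : Prop := forall b x, x \in homogeneous G i ->
  f b * x \in homogeneous G i /\ x * f b \in homogeneous G i.

Definition piece of bimodule_part : Type := part G i.

Variable closed : bimodule_part.
Local Notation P := (piece closed).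

HB.instance Definition _ := GRing.Lmodule.on P.

Definition piece_val (x : P) : Om := part_val x.

Definition piece_lact b x : P := Part (closed b (part_homogeneous x)).1.
Definition piece_ract x b : P := Part (closed b (part_homogeneous x)).2.

Fact piece_lactDl b c x : piece_lact (b + c) x = piece_lact b x + piece_lact c x.
Proof. by apply: val_inj; rewrite /= rmorphD mulrDl. Qed.
Fact piece_lactDr b x y : piece_lact b (x + y) = piece_lact b x + piece_lact b y.
Proof. by apply: val_inj; rewrite /= mulrDr. Qed.
Fact piece_lactA b c x : piece_lact b (piece_lact c x) = piece_lact (b * c) x.
Proof. by apply: val_inj; rewrite /= rmorphM mulrA. Qed.
Fact piece_lact1 x : piece_lact 1 x = x.
Proof. by apply: val_inj; rewrite /= rmorph1 mul1r. Qed.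
Fact piece_lactZ (a : C) b x : piece_lact (a *: b) x = a *: piece_lact b x.
Proof. by apply: val_inj; rewrite /= linearZ /= scalerAl. Qed.
Fact piece_ractDl x y b : piece_ract (x + y) b = piece_ract x b + piece_ract y b.
Proof. by apply: val_inj; rewrite /= mulrDl. Qed.
Fact piece_ractDr x b c : piece_ract x (b + c) = piece_ract x b + piece_ract x c.
Proof. by apply: val_inj; rewrite /= rmorphD mulrDr. Qed.
Fact piece_ractA x b c : piece_ract (piece_ract x b) c = piece_ract x (b * c).
Proof. by apply: val_inj; rewrite /= rmorphM mulrA. Qed.
Fact piece_ract1 x : piece_ract x 1 = x.
Proof. by apply: val_inj; rewrite /= rmorph1 mulr1. Qed.
Fact piece_ractZ (a : C) x b : piece_ract x (a *: b) = a *: piece_ract x b.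
Proof. by apply: val_inj; rewrite /= linearZ /= scalerAr. Qed.
Fact piece_lractA b x c : piece_ract (piece_lact b x) c = piece_lact b (piece_ract x c).
Proof. by apply: val_inj; rewrite /= mulrA. Qed.

HB.instance Definition _ := isBimodule.Build C B P
  piece_lactDl piece_lactDr piece_lactA piece_lact1 piece_lactZ
  piece_ractDl piece_ractDr piece_ractA piece_ract1 piece_ractZ piece_lractA.

End Piece.

(* B is identified with Omega^0 through iota.                                 *)
Record calculus (C : numClosedFieldType) (B : algType C) := Calculus {
  forms : algType C;
  degree : grading forms nat;
  iota : {lrmorphism B -> forms};
  diff : {linear forms -> forms};
  iota_inj : injective iota;
  iota_im : forall x, x \in homogeneous degree 0 <-> exists b, x = iota b;
  degreeM : forall k l x y, x \in homogeneous degree k ->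
    y \in homogeneous degree l -> x * y \in homogeneous degree (k + l);
  degree_diff : forall k x, x \in homogeneous degree k ->
    diff x \in homogeneous degree k.+1;
  diff_diff : forall x, diff (diff x) = 0;
  diffM : forall k x y, x \in homogeneous degree k ->
    diff (x * y) = diff x * y + (-1) ^+ k *: (x * diff y);
  generated : forall P : {pred forms}, subalg_closed P ->
    (forall b, iota b \in P) -> (forall b, diff (iota b) \in P) ->
    forall x, x \in P
}.

Record starCalculus (C : numClosedFieldType) (B : starAlgType C) := StarCalculus {
  calc :> calculus B;
  fstar : forms calc -> forms calc;
  fstarD : forall x y, fstar (x + y) = fstar x + fstar y;
  fstarZ : forall (k : C) x, fstar (k *: x) = k^* *: fstar x;
  fstarK : forall x, fstar (fstar x) = x;
  fstar_iota : forall b, fstar (iota calc b) = iota calc (star b);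
  fstar_degree : forall k x, x \in homogeneous (degree calc) k ->
    fstar x \in homogeneous (degree calc) k;
  fstar_diff : forall x, fstar (diff calc x) = diff calc (fstar x);
  fstarM : forall k l x y, x \in homogeneous (degree calc) k ->
    y \in homogeneous (degree calc) l ->
    fstar (x * y) = (-1) ^+ (k * l) *: (fstar y * fstar x)
}.

Record complexStructure (C : numClosedFieldType) (B : starAlgType C)
    (X : starCalculus B) := ComplexStructure {
  bidegree : grading (forms X) (nat * nat)%type;
  bidegree_degree : forall k x,
    proj (degree X) k x = \sum_(p < k.+1) proj bidegree (val p, (k - p)%N) x;
  bidegreeM : forall p q p' q' x y, x \in homogeneous bidegree (p, q) ->
    y \in homogeneous bidegree (p', q') ->
    x * y \in homogeneous bidegree (p + p', q + q')%N;
  bidegree_fstar : forall p q x, x \in homogeneous bidegree (p, q) ->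
    fstar x \in homogeneous bidegree (q, p);
  bidegree_diff : forall p q x, x \in homogeneous bidegree (p, q) ->
    exists y z, [/\ y \in homogeneous bidegree (p.+1, q),
      z \in homogeneous bidegree (p, q.+1) & diff X x = y + z]
}.

Section Forms.
Variables (C : numClosedFieldType) (B : algType C) (X : calculus B).

Fact iota_degree b : iota X b \in homogeneous (degree X) 0.
Proof. by apply/iota_im; exists b. Qed.

Fact dform_closed k : bimodule_part (iota X) (degree X) k.
Proof.
move=> b x hx; split; first exact: degreeM (iota_degree b) hx.
by rewrite -[k]addn0; apply: degreeM hx (iota_degree b).
Qed.

Definition dform (k : nat) : Type := piece (@dform_closed k).
HB.instance Definition _ k := Bimodule.on (dform k).

Definition dform_val k (x : dform k) : forms X := part_val x.

End Forms.

Definition dfun (C : numClosedFieldType) (B : algType C) (X : calculus B)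
    (b : B) : dform X 1 := Part (degree_diff (iota_degree X b)).

Definition fstar1 (C : numClosedFieldType) (B : starAlgType C)
    (X : starCalculus B) (w : dform X 1) : dform X 1 :=
  Part (fstar_degree (part_homogeneous w)).

Section BiForms.
Variables (C : numClosedFieldType) (B : starAlgType C) (X : starCalculus B).
Variable S : complexStructure X.

Fact iota_bidegree b : iota X b \in homogeneous (bidegree S) (0, 0)%N.
Proof.
have /eqP := iota_degree X b; rewrite (bidegree_degree S) big_ord1 /= => h.
by apply/eqP.
Qed.

Fact bform_closed p q : bimodule_part (iota X) (bidegree S) (p, q).
Proof.
move=> b x hx; split; first exact: bidegreeM (iota_bidegree b) hx.
by have := bidegreeM hx (iota_bidegree b); rewrite !addn0.
Qed.

Definition bform (p q : nat) : Type := piece (@bform_closed p q).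
HB.instance Definition _ p q := Bimodule.on (bform p q).

Definition bform_val p q (x : bform p q) : forms X := part_val x.
Definition to_bform p q (x : forms X) : bform p q := to_part (bidegree S) (p, q) x.

Definition wedge p q p' q' (x : bform p q) (y : bform p' q') :
    bform (p + p') (q + q') :=
  Part (bidegreeM (part_homogeneous x) (part_homogeneous y)).

Fact wedge_antihol_hol_subproof p q (x : bform 0 q) (y : bform p 0) :
  bform_val x * bform_val y \in homogeneous (bidegree S) (p, q).
Proof.
by have := bidegreeM (part_homogeneous x) (part_homogeneous y); rewrite addn0.
Qed.
Fact wedge_hol_antihol_subproof p q (x : bform p 0) (y : bform 0 q) :
  bform_val x * bform_val y \in homogeneous (bidegree S) (p, q).
Proof.
by have := bidegreeM (part_homogeneous x) (part_homogeneous y); rewrite addn0.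
Qed.

(* Omega^(0,q) (x)_B Omega^(p,0) -> Omega^(p,q) *)
Definition wedge_antihol_hol p q (t : btens (bform 0 q) (bform p 0)) : bform p q :=
  tlift (fun x y => Part (wedge_antihol_hol_subproof x y) : bform p q) t.
(* Omega^(p,0) (x)_B Omega^(0,q) -> Omega^(p,q) *)
Definition wedge_hol_antihol p q (t : btens (bform p 0) (bform 0 q)) : bform p q :=
  tlift (fun x y => Part (wedge_hol_antihol_subproof x y) : bform p q) t.

Definition factorizable : Prop :=
  forall p q, bijective (@wedge_antihol_hol p q) /\ bijective (@wedge_hol_antihol p q).

Definition delbar p q (x : bform p q) : bform p q.+1 :=
  to_bform p q.+1 (diff X (bform_val x)).
Definition delbar_fun (b : B) : bform 0 1 := to_bform 0 1 (diff X (iota X b)).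

Definition pi01 (w : dform X 1) : bform 0 1 := to_bform 0 1 (part_val w).

Lemma bidegree_homogeneous p q x : x \in homogeneous (bidegree S) (p, q) ->
  x \in homogeneous (degree X) (p + q).
Proof.
move=> hx; apply/eqP; rewrite (bidegree_degree S).
have lt : (p < (p + q).+1)%N by rewrite ltnS leq_addr.
rewrite (bigD1 (Ordinal lt)) //= addKn (eqP hx) big1 ?addr0 // => i ne.
apply: proj_neq hx _; apply: contraNneq ne => -[e _].
by apply/eqP/val_inj.
Qed.

Lemma proj_diffM p q p' q' x y :
  x \in homogeneous (bidegree S) (p, q) ->
  y \in homogeneous (bidegree S) (p', q') ->
  proj (bidegree S) (p + p', (q + q').+1)%N (diff X (x * y)) =
  proj (bidegree S) (p, q.+1) (diff X x) * y +
  (-1) ^+ (p + q) *: (x * proj (bidegree S) (p', q'.+1) (diff X y)).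
Proof.
move=> hx hy; rewrite (diffM _ (bidegree_homogeneous hx)).
have [x1 [x2 [hx1 hx2 ->]]] := bidegree_diff hx.
have [y1 [y2 [hy1 hy2 ->]]] := bidegree_diff hy.
have px : proj (bidegree S) (p, q.+1) (x1 + x2) = x2.
  rewrite linearD (proj_neq hx1) ?add0r ?(eqP hx2) //.
  by rewrite xpair_eqE negb_and neq_ltn ltnSn.
have py : proj (bidegree S) (p', q'.+1) (y1 + y2) = y2.
  rewrite linearD (proj_neq hy1) ?add0r ?(eqP hy2) //.
  by rewrite xpair_eqE negb_and neq_ltn ltnSn.
rewrite px py mulrDl mulrDr scalerDr !linearD !linearZ /=.
have e1 := bidegreeM hx1 hy; have e2 := bidegreeM hx2 hy.
have e3 := bidegreeM hx hy1; have e4 := bidegreeM hx hy2.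
rewrite (proj_neq e1) ?(proj_neq e3);
  try by rewrite xpair_eqE negb_and ?addSn ?addnS neq_ltn ltnSn.
rewrite scaler0 !add0r; rewrite addSn in e2; rewrite addnS in e4.
by rewrite (eqP e2) (eqP e4).
Qed.

Lemma proj_diff_diff p q x : x \in homogeneous (bidegree S) (p, q) ->
  proj (bidegree S) (p, q.+2)
    (diff X (proj (bidegree S) (p, q.+1) (diff X x))) = 0.
Proof.
move=> hx; have := diff_diff (c:=X) x.
have [y [z [hy hz ->]]] := bidegree_diff hx.
have [y1 [y2 [hy1 hy2 ey]]] := bidegree_diff hy.
have [z1 [z2 [hz1 hz2 ez]]] := bidegree_diff hz.
rewrite !linearD /= (proj_neq hy) ?linear0 ?add0r ?(eqP hz) ?ez ?ey => [e|].
  have /(congr1 (proj (bidegree S) (p, q.+2))) := e.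
  rewrite !linearD linear0 /= (proj_neq hy1) ?(proj_neq hy2) ?add0r //;
  by rewrite xpair_eqE negb_and neq_ltn ?ltnSn // ltnS leqnSn.
by rewrite xpair_eqE negb_and neq_ltn ltnSn.
Qed.

Section Holomorphic.
Variable E : bimodType B.

(* x /\ (y (x) e) = (x /\ y) (x) e *)
Definition wedge_tens (x : bform 0 1) (t : btens (bform 0 1) E) :
    btens (bform 0 2) E :=
  tlift (fun y e => bpure (wedge x y : bform 0 2) e) t.

(* delbar (x) id - id /\ delbarE; only the difference is balanced. *)
Definition holomorphic_curvature (delbarE : E -> btens (bform 0 1) E)
    (t : btens (bform 0 1) E) : btens (bform 0 2) E :=
  tlift (fun x e => bpure (delbar x : bform 0 2) e - wedge_tens x (delbarE e)) t.

Record holomorphicStructure := HolomorphicStructure {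
  delbarE :> E -> btens (bform 0 1) E;
  delbarE_linear : linear delbarE;
  delbarE_leibniz : forall b e,
    delbarE (lact b e) = lact b (delbarE e) + bpure (delbar_fun b) e;
  delbarE_flat : forall e, holomorphic_curvature delbarE (delbarE e) = 0
}.

End Holomorphic.

Section Omega10.
Hypothesis fact : factorizable.
Variable theta : bform 1 1 -> btens (bform 0 1) (bform 1 0).
Hypothesis thetaK : cancel theta (@wedge_antihol_hol 1 1).

Definition delbar10 (e : bform 1 0) : btens (bform 0 1) (bform 1 0) :=
  theta (delbar e).

Fact wedge_balanced p q : balanced (@ract _ _ (bform 0 q)) (@lact _ _ (bform p 0))
  (fun x y => Part (wedge_antihol_hol_subproof x y) : bform p q).
Proof.
split=> *; apply: val_inj; rewrite /= /bform_val /=.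
- by rewrite mulrDl.
- by rewrite mulrDr.
- by rewrite mulrA.
Qed.

Lemma wedgeE p q (x : bform 0 q) (y : bform p 0) :
  bform_val (wedge_antihol_hol (bpure x y)) = bform_val x * bform_val y.
Proof. by rewrite /wedge_antihol_hol (tliftE (wedge_balanced p q)). Qed.

Lemma wedgeD p q (s t : btens (bform 0 q) (bform p 0)) :
  wedge_antihol_hol (s + t) = wedge_antihol_hol s + wedge_antihol_hol t.
Proof. by rewrite /wedge_antihol_hol (tliftD (wedge_balanced p q)). Qed.

Lemma bform_valD p q (x y : bform p q) : bform_val (x + y) = bform_val x + bform_val y.
Proof. by []. Qed.

Lemma bform_val_inj p q : injective (@bform_val p q).
Proof. exact: val_inj. Qed.

Lemma bform_valZ p q k (x : bform p q) : bform_val (k *: x) = k *: bform_val x.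
Proof. by []. Qed.

Lemma bform_val_lact p q b (x : bform p q) :
  bform_val (lact b x) = iota X b * bform_val x.
Proof. by []. Qed.

Lemma wedgeZ p q k (t : btens (bform 0 q) (bform p 0)) :
  wedge_antihol_hol (k *: t) = k *: wedge_antihol_hol t.
Proof.
move: t; apply: tens_ext => [s t|s t|x y] /=.
- by rewrite scalerDr wedgeD.
- by rewrite wedgeD scalerDr.
- rewrite -/(bpure x y) [k *: bpure x y]btens_scaleE.
  by apply: bform_val_inj; rewrite bform_valZ !wedgeE bform_valZ scalerAl.
Qed.

Lemma wedge_lact p q b (t : btens (bform 0 q) (bform p 0)) :
  wedge_antihol_hol (lact b t) = lact b (wedge_antihol_hol t).
Proof.
move: t; apply: tens_ext => [s t|s t|x y] /=.
- by rewrite lactDr wedgeD.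
- by rewrite wedgeD lactDr.
- rewrite -/(bpure x y) [lact b (bpure x y)]btens_lactE.
  by apply: bform_val_inj; rewrite bform_val_lact !wedgeE bform_val_lact mulrA.
Qed.

Lemma wedge_inj p q : injective (@wedge_antihol_hol p q).
Proof. exact: bij_inj (fact p q).1. Qed.

Fact delbar_linear p q : linear (@delbar p q).
Proof.
move=> k x y; apply: bform_val_inj.
by rewrite /bform_val /= !linearP.
Qed.

Fact delbar10_linear : linear delbar10.
Proof.
move=> k x y; apply: wedge_inj.
by rewrite wedgeD wedgeZ !thetaK delbar_linear.
Qed.

Fact delbar10_leibniz b e :
  delbar10 (lact b e) = lact b (delbar10 e) + bpure (delbar_fun b) e.
Proof.
apply: wedge_inj; rewrite wedgeD wedge_lact !thetaK; apply: bform_val_inj.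
rewrite bform_valD wedgeE /bform_val /=.
have := proj_diffM (iota_bidegree b) (part_homogeneous e).
by rewrite /= expr0 scale1r addrC.
Qed.

Lemma wedge_wedgel (x : bform 0 1) (t : btens (bform 0 1) (bform 1 0)) :
  bform_val (wedge_antihol_hol (wedge_tens x t)) =
  bform_val x * bform_val (wedge_antihol_hol t).
Proof.
have bal : balanced (@ract _ _ (bform 0 1)) (@lact _ _ (bform 1 0))
    (fun y e => bpure (wedge x y : bform 0 2) e).
  have [hl hr hb] := bpure_balanced (bform 0 2) (bform 1 0).
  split=> [y y' e|y e e'|y b e]; rewrite -?hr -?hl -?hb //; congr bpure;
    by apply: val_inj; rewrite /= ?mulrDr ?mulrA.
rewrite /wedge_tens; move: t; apply: tens_ext => [s t|s t|y e] /=.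
- by rewrite (tliftD bal) wedgeD.
- by rewrite wedgeD bform_valD mulrDr.
- by rewrite (tliftE bal) wedgeE -/(bpure y e) wedgeE mulrA.
Qed.

Fact delbar10_flat e : holomorphic_curvature delbar10 (delbar10 e) = 0.
Proof.
pose k (x : bform 0 1) (e : bform 1 0) : btens (bform 0 2) (bform 1 0) :=
  bpure (delbar x) e - wedge_tens x (delbar10 e).
have wN s t : wedge_antihol_hol (s - t) =
    wedge_antihol_hol s - wedge_antihol_hol t :> bform 1 2.
  by rewrite wedgeD -scaleN1r wedgeZ scaleN1r.
have kE x y : bform_val (wedge_antihol_hol (k x y)) =
    proj (bidegree S) (1, 2)%N (diff X (bform_val x * bform_val y)).
  rewrite wN /bform_val /= -!/(bform_val _) wedgeE wedge_wedgel thetaK.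
  rewrite (proj_diffM (part_homogeneous x) (part_homogeneous y)) /= expr1.
  by rewrite scaleN1r.
have bal : balanced (@ract _ _ (bform 0 1)) (@lact _ _ (bform 1 0)) k.
  split=> *; apply: wedge_inj; apply: bform_val_inj;
    rewrite ?[wedge_antihol_hol (k _ _ + k _ _)]wedgeD
            ?[bform_val (wedge_antihol_hol (k _ _) + _)]bform_valD !kE.
  - by rewrite bform_valD mulrDl !linearD.
  - by rewrite bform_valD mulrDr !linearD.
  - by rewrite /bform_val /= mulrA.
have KE t : bform_val (wedge_antihol_hol (tlift k t)) =
    proj (bidegree S) (1, 2)%N (diff X (bform_val (wedge_antihol_hol t))).
  move: t; apply: tens_ext => [s t|s t|x y] /=.
  - by rewrite (tliftD bal) wedgeD.
  - by rewrite wedgeD bform_valD !linearD.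
  - by rewrite (tliftE bal) kE -/(bpure x y) wedgeE.
apply: wedge_inj; apply: bform_val_inj; rewrite KE thetaK.
rewrite (proj_diff_diff (part_homogeneous e)).
by rewrite /wedge_antihol_hol (tlift0 (wedge_balanced 1 2)).
Qed.

Definition Omega10_holomorphic : holomorphicStructure (bform 1 0) :=
  HolomorphicStructure delbar10_linear delbar10_leibniz delbar10_flat.

End Omega10.

End BiForms.

Section Covariance.
Variables (C : numClosedFieldType) (A : hopfStarAlgType C).
Variables (B : comoduleStarAlgType A) (X : starCalculus B).

Definition dform_coact (delta : forms X -> ctens A (forms X)) (k : nat)
    (x : dform X k) : ctens A (dform X k) := part_coact delta x.

Record covariantCalculus := CovariantCalculus {
  fcoact : forms X -> ctens A (forms X);
  fcoactP : left_coaction fcoact;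
  fcoact1 : fcoact 1 = cpure 1 1;
  fcoactM : forall x y, fcoact (x * y) = cmul *%R (fcoact x) (fcoact y);
  fcoact_star : forall x, fcoact (fstar x) = cmap star (@fstar _ _ X) (fcoact x);
  fcoact_iota : forall b, fcoact (iota X b) = cmap idfun (iota X) (coact b);
  fcoact_degree : forall k, subcomodule (degree X) k fcoact;
  fcoact_form : forall k, covariant_bimodule (@dform_coact fcoact k);
  fcoact_diff : colinear fcoact fcoact (diff X)
}.

Variables (S : complexStructure X) (cov : covariantCalculus).

Definition covariant_complex : Prop :=
  forall p q, subcomodule (bidegree S) (p, q) (fcoact cov).

Definition bform_coact (p q : nat) (x : bform S p q) : ctens A (bform S p q) :=
  part_coact (fcoact cov) x.

End Covariance.

Section Metric.
Variables (C : numClosedFieldType) (B : starAlgType C) (E : bimodType B).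

Record hermitianMetric := HermitianMetric {
  metric :> conjugate E -> leftHom E;
  metric_linear : linear metric;
  metric_lact : forall b x, metric (lact b x) = lact b (metric x);
  metric_ract : forall x b, metric (ract x b) = ract (metric x) b;
  metric_bij : bijective metric;
  metric_sym : forall e f, star (metric (cj e) f) = metric (cj f) e
}.

(* <e, x> for x in the conjugate of E *)
Definition pairing (h : hermitianMetric) (e : E) (x : conjugate E) : B := h x e.

End Metric.

Section CovariantMetric.
Variables (C : numClosedFieldType) (A : hopfStarAlgType C).
Variables (B : comoduleStarAlgType A) (E : bimodType B).
Variable delta : E -> ctens A E.

(* f_(-1) (x) f_(0)(m) = S(m_(-1)) f(m_(0))_(-1) (x) f(m_(0))_(0). For E       *)
(* finitely generated projective there is exactly one such deltaH.            *)
Definition leftHom_coaction (deltaH : leftHom E -> ctens A (leftHom E)) : Prop :=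
  forall f m, cmap idfun (fun g : leftHom E => g m) (deltaH f) =
    tlift (fun a m0 => cmap (fun a' => antipode a * a') idfun (coact (f m0)))
      (delta m).

Definition covariant_metric (h : hermitianMetric E) : Prop :=
  exists deltaH, leftHom_coaction deltaH /\
    colinear (conjugate_coact delta) deltaH h.

End CovariantMetric.

Section Connection.
Variables (C : numClosedFieldType) (B : starAlgType C) (X : starCalculus B).
Variable E : bimodType B.

Definition left_connection (nabla : E -> btens (dform X 1) E) : Prop :=
  linear nabla /\
  forall b e, nabla (lact b e) = lact b (nabla e) + bpure (dfun X b) e.

(* nabla~ (conj f) = conj x_i (x) w_i^* for nabla f = w_i (x) x_i *)
Definition conj_connection (nabla : E -> btens (dform X 1) E) (x : conjugate E) :
    btens (conjugate E) (dform X 1) :=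
  tlift (fun w e => bpure (cj e) (fstar1 w)) (nabla (uncj x)).

(* (id (x) <,>) (t (x) x) and (<,> (x) id) (e (x) t), where Omega^1 (x)_B B   *)
(* and B (x)_B Omega^1 are identified with Omega^1.                           *)
Definition pair_right (h : hermitianMetric E) (t : btens (dform X 1) E)
    (x : conjugate E) : dform X 1 :=
  tlift (fun w e => ract w (pairing h e x)) t.
Definition pair_left (h : hermitianMetric E) (e : E)
    (t : btens (conjugate E) (dform X 1)) : dform X 1 :=
  tlift (fun x w => lact (pairing h e x) w) t.

Definition metric_compatible (h : hermitianMetric E)
    (nabla : E -> btens (dform X 1) E) : Prop :=
  forall e f, dfun X (pairing h e (cj f)) =
    pair_right h (nabla e) (cj f) + pair_left h e (conj_connection nabla (cj f)).

Variable S : complexStructure X.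

Definition chern_connection (D : holomorphicStructure S E)
    (h : hermitianMetric E) (nabla : E -> btens (dform X 1) E) : Prop :=
  [/\ left_connection nabla, metric_compatible h nabla
    & forall e, bmap (@pi01 _ _ _ S) idfun (nabla e) = D e].

End Connection.

Definition covariant_connection (C : numClosedFieldType) (A : hopfStarAlgType C)
    (B : comoduleStarAlgType A) (X : starCalculus B) (cov : covariantCalculus X)
    (E : bimodType B) (delta : E -> ctens A E)
    (nabla : E -> btens (dform X 1) E) : Prop :=
  colinear delta (btens_coact (@dform_coact _ _ _ _ (fcoact cov) 1) delta) nabla.

Arguments wedge_antihol_hol {C B X} S p q t.
Arguments bform_coact {C A B X} S cov p q x.

(* Main.v *)
From HB Require Import structures.
Require Import Defs.
From mathcomp Require Import all_boot all_order all_algebra.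
From mathcomp Require Import boolp reals complex.

(** Write E for Omega^(1,0), D for its holomorphic structure, <e, x> for the
metric pairing of e in E with x in the conjugate module of E, and delta for
every coaction.

The Chern connection is given by an explicit formula.  Star exchanges the (1,0)-
and the (0,1)-forms, so in the Omega^(1,0)-component of the compatibility
identity only the (0,1)-part of nabla f is left under the conjugation, and that
part is D f.  Writing (t | x) for the one-form obtained by pairing the
E-factor of t in Omega^1 (x)_B E with x, and del for the (1,0)-part of d, this gives ([pair_nabla])
[[
  (nabla e | conj f) =
    (D e | conj f) + del <e, conj f> - <e, conj (D f)>
]]
Every ingredient on the right is colinear: the projections because all
Omega^(p,q) are subcomodules; D because the wedge map is colinear, hence so is
its inverse theta ([D_colinear]); and the pairing because colinearity of the
metric, which a priori reads through the antipode, unfolds to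
delta <e, x> = e_(-1) x_(-1) (x) <e_(0), x_(0)> ([colinear_pairing]).  Hence
delta ((nabla e | x)) can be computed in two ways, and the two tensors
delta (nabla e) and (id (x) nabla) delta(e) have the same image under
y |-> y_(-1) x_(-1) (x) (y_(0) | x_(0)) for every x.

It remains to remove x.  The twist by x_(-1) is undone with
S^-1 = star S star, the antipode of the co-opposite Hopf algebra
([pairing_cancel]); so the two tensors agree after pairing with each fixed x.
Finally Omega^1 is finitely generated projective and E is a direct summand of
it, so E has a finite dual basis e_i, phi_i ([Omega10_dual_basis]); the metric
is bijective, so each phi_i is <-, g_i> for some g_i, and
t = sum_i (t | g_i) (x) e_i recovers t from its pairings.

Throughout, an identity between maps out of tensor products is checked on pure
tensors; semilinearity along a map of scalars lets conjugations and linear maps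
share these arguments. *)

Set Implicit Arguments.
Unset Strict Implicit.
Unset Printing Implicit Defensive.

Import GRing.Theory Num.Theory.

Local Open Scope ring_scope.

(** * Semilinear maps and tensor products over the complex numbers *)

Section ComplexTensorTheory.
Variable C : numClosedFieldType.

(** The map s records how scalars are twisted: the identity for linear maps,
conjugation for the star operations. *)
Definition slinear (s : C -> C) (M N : lmodType C) (f : M -> N) : Prop :=
  {morph f : x y / x + y} /\ forall k x, f (k *: x) = s k *: f x.

Definition bilin (M N P : lmodType C) (op : M -> N -> P) : Prop :=
  (forall m, slinear id (op m)) /\ (forall n, slinear id (op^~ n)).

Lemma slinear0 s (M N : lmodType C) (f : M -> N) : slinear s f -> f 0 = 0.
Proof. by case=> fD _; apply: (@addrI _ (f 0)); rewrite -fD !addr0. Qed.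

Lemma slinear_sum s (M N : lmodType C) (f : M -> N) I (r : seq I) (F : I -> M) :
  slinear s f -> f (\sum_(i <- r) F i) = \sum_(i <- r) f (F i).
Proof.
move=> fl; apply: (big_morph f fl.1); exact: slinear0 fl.
Qed.

Lemma linear_slinear (M N : lmodType C) (f : M -> N) : linear f -> slinear id f.
Proof.
move=> fl; have f0 : f 0 = 0.
  by have := fl (-1) 0 0; rewrite scaler0 addr0 scaleN1r addNr.
split=> [x y|k x]; first by have := fl 1 x y; rewrite !scale1r.
by have := fl k x 0; rewrite !addr0 f0 addr0.
Qed.

Lemma slinear_id (M : lmodType C) : slinear id (@idfun M).
Proof. by []. Qed.

Lemma slinear_comp s s' (M N P : lmodType C) (f : N -> P) (g : M -> N) :
  slinear s f -> slinear s' g -> slinear (s \o s') (f \o g).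
Proof.
by move=> [fD fZ] [gD gZ]; split=> [x y|k x] /=; rewrite ?gD ?fD ?gZ ?fZ.
Qed.

Lemma slinear_scale (V : lmodType C) (k : C) : slinear id (fun v : V => k *: v).
Proof. by split=> [x y|l x]; rewrite ?scalerDr // !scalerA mulrC. Qed.

Section FamiliesOfLifts.
Variables (R : Type) (M N : zmodType) (ra : M -> R -> M) (la : R -> N -> N).

Lemma eq_tlift (V : zmodType) (F G : M -> N -> V) :
  F =2 G -> (tlift F : tens ra la -> V) =1 tlift G.
Proof. by move=> e x; apply: eq_bigr => p _; apply: e. Qed.

Lemma tlift_funD (V : zmodType) (F G : M -> N -> V) (x : tens ra la) :
  tlift (fun m n => F m n + G m n) x = tlift F x + tlift G x.
Proof. exact: big_split. Qed.

Lemma tlift_fun s (V V' : lmodType C) (f : V -> V') (F : M -> N -> V)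
    (x : tens ra la) : slinear s f ->
  tlift (fun m n => f (F m n)) x = f (tlift F x).
Proof. by move=> fl; rewrite /tlift (slinear_sum _ _ fl). Qed.

(** A lift is a finite sum of values of F, so it depends on a parameter as F does,
whether or not F is balanced. *)
Lemma tlift_param (P V : lmodType C) (F : P -> M -> N -> V) (x : tens ra la) :
  (forall m n, slinear id (fun p => F p m n)) ->
  slinear id (fun p => tlift (F p) x).
Proof.
move=> Fl; split=> [p q|k p].
  by rewrite -tlift_funD; apply: eq_tlift => m n; apply: (Fl m n).1.
rewrite -(tlift_fun _ _ (slinear_scale V k)).
by apply: eq_tlift => m n; apply: (Fl m n).2.
Qed.

End FamiliesOfLifts.

Lemma bilin_balanced (M N P : lmodType C) (op : M -> N -> P) : bilin op ->
  balanced (fun (m : M) (c : C) => c *: m) (fun (c : C) (n : N) => c *: n) op.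
Proof.
move=> [hr hl]; split=> *; first exact: (hl _).1; first exact: (hr _).1.
by rewrite (hr _).2; apply: (hl _).2.
Qed.

Lemma ctens_ext (M N : lmodType C) (V : zmodType) (f g : ctens M N -> V) :
  {morph f : x y / x + y} -> {morph g : x y / x + y} ->
  (forall m n, f (cpure m n) = g (cpure m n)) -> f =1 g.
Proof. exact: tens_ext. Qed.

Lemma scale_cpure (M N : lmodType C) k (m : M) (n : N) :
  k *: cpure m n = cpure (k *: m) n.
Proof. exact: ctens_scaleE. Qed.

Lemma cpure_bilin (M N : lmodType C) : bilin (@cpure C M N).
Proof.
have [hl hr hb] := cpure_balanced M N.
by split=> [m|n]; split=> *; rewrite ?scale_cpure //=.
Qed.

Section Lift.
Variables (M N V : lmodType C) (F : M -> N -> V) (Fb : bilin F).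

Lemma cliftE m n : tlift F (cpure m n) = F m n.
Proof. exact: tliftE (bilin_balanced Fb) m n. Qed.

Lemma clift_slinear : slinear id (tlift F : ctens M N -> V).
Proof.
have lD : {morph (tlift F : ctens M N -> V) : x y / x + y}.
  exact: tliftD (bilin_balanced Fb).
split=> // k; apply: ctens_ext => [x y|x y|m n] /=.
- by rewrite scalerDr lD.
- by rewrite lD scalerDr.
- by rewrite scale_cpure !cliftE (Fb.2 n).2.
Qed.

End Lift.

Section Map.
Variables (s : C -> C) (M N M' N' : lmodType C) (f : M -> M') (g : N -> N').
Hypotheses (fl : slinear s f) (gl : slinear s g).

Fact cmap_balanced : balanced (fun (m : M) (c : C) => c *: m)
  (fun (c : C) (n : N) => c *: n) (fun m n => cpure (f m) (g n)).
Proof.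
have [hl hr hb] := cpure_balanced M' N'.
split=> [m m' n|m n n'|m c n]; first by rewrite fl.1 hl.
- by rewrite gl.1 hr.
- by rewrite fl.2 gl.2 hb.
Qed.

Lemma cmapE m n : cmap f g (cpure m n) = cpure (f m) (g n).
Proof. exact: tliftE cmap_balanced m n. Qed.

Lemma cmap_slinear : slinear s (cmap f g).
Proof.
have lD : {morph cmap f g : x y / x + y} by apply: tliftD cmap_balanced.
split=> // k; apply: ctens_ext => [x y|x y|m n] /=.
- by rewrite scalerDr lD.
- by rewrite lD scalerDr.
- by rewrite scale_cpure !cmapE scale_cpure fl.2.
Qed.

End Map.

Lemma eq_cmap (M N M' N' : lmodType C) (f f' : M -> M') (g g' : N -> N') :
  f =1 f' -> g =1 g' -> cmap f g =1 cmap f' g'.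
Proof. by move=> e e'; apply: eq_tlift => m n; rewrite e e'. Qed.

Lemma cmap_comp s s' (M N M1 N1 M2 N2 : lmodType C) (f : M1 -> M2) (g : N1 -> N2)
    (f' : M -> M1) (g' : N -> N1) :
  slinear s f -> slinear s g -> slinear s' f' -> slinear s' g' ->
  forall x, cmap f g (cmap f' g' x) = cmap (f \o f') (g \o g') x.
Proof.
move=> fl gl fl' gl'.
have fc := slinear_comp fl fl'; have gc := slinear_comp gl gl'.
have [hD _] := cmap_slinear fl gl; have [hD' _] := cmap_slinear fl' gl'.
apply: ctens_ext => [x y|x y|m n]; first by rewrite hD' hD.
- by rewrite (cmap_slinear fc gc).1.
- by rewrite (cmapE fl' gl') (cmapE fl gl) (cmapE fc gc).
Qed.

Lemma cmap_id (M N : lmodType C) (f : M -> M) (g : N -> N) :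
  f =1 id -> g =1 id -> forall x, cmap f g x = x.
Proof.
move=> fE gE x; rewrite (eq_cmap fE gE); move: x.
have il := @slinear_id M; have il' := @slinear_id N.
apply: ctens_ext => [x y|x y|m n] //; first exact: (cmap_slinear il il').1.
by rewrite (cmapE il il').
Qed.

Lemma ctens_ext2 (M N M' N' V : lmodType C)
    (f g : ctens M N -> ctens M' N' -> V) : bilin f -> bilin g ->
  (forall m n m' n', f (cpure m n) (cpure m' n') = g (cpure m n) (cpure m' n')) ->
  f =2 g.
Proof.
move=> [fr fl] [gr gl] e x y; move: x.
apply: ctens_ext => [x x'|x x'|m n]; [exact: (fl _).1|exact: (gl _).1|].
move: y; apply: ctens_ext => [y y'|y y'|m' n'] //.
  exact: (fr _).1.
exact: (gr _).1.
Qed.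

Section Mul.
Variables (A : algType C).

Lemma mul_bilin : bilin (@GRing.mul A).
Proof.
by split=> a; split=> [x y|k x]; rewrite /= ?mulrDr ?mulrDl -?scalerAr -?scalerAl.
Qed.

Section One.
Variables (M N P : lmodType C) (op : M -> N -> P) (opb : bilin op).

Fact cmul_inner (a : A) m : bilin (fun (a' : A) n => cpure (a * a') (op m n)).
Proof.
have [cr cl] := cpure_bilin A P; have [mr ml] := mul_bilin.
split=> [b|n]; first exact: slinear_comp (cr _) (opb.1 m).
exact: slinear_comp (cl _) (mr a).
Qed.

Fact cmul_outer (y : ctens A N) :
  bilin (fun a m => tlift (fun a' n => cpure (a * a') (op m n)) y).
Proof.
have [cr cl] := cpure_bilin A P; have [mr ml] := mul_bilin.
split=> [a|m]; apply: tlift_param => b n.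
  exact: slinear_comp (cr _) (opb.2 n).
exact: slinear_comp (cl _) (ml b).
Qed.

Lemma cmulE (a a' : A) m n :
  cmul op (cpure a m) (cpure a' n) = cpure (a * a') (op m n).
Proof. by rewrite /cmul (cliftE (cmul_outer _)) (cliftE (cmul_inner _ _)). Qed.

Lemma cmul_bilin : bilin (cmul op : ctens A M -> ctens A N -> ctens A P).
Proof.
split=> [x|y]; last exact: clift_slinear (cmul_outer y).
apply: tlift_param => a m; exact: clift_slinear (cmul_inner a m).
Qed.

End One.

Lemma eq_cmul (M N P : lmodType C) (op op' : M -> N -> P) (x : ctens A M) y :
  op =2 op' -> cmul op x y = cmul op' x y.
Proof. by move=> e; apply: eq_tlift => a m; apply: eq_tlift => a' n; rewrite e. Qed.

Lemma bilin_comp (M N P M' N' : lmodType C) (op : M -> N -> P)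
    (f : M' -> M) (g : N' -> N) : bilin op -> slinear id f -> slinear id g ->
  bilin (fun m n => op (f m) (g n)).
Proof.
move=> [hr hl] fl gl; split=> [m|n]; first exact: slinear_comp (hr _) gl.
exact: slinear_comp (hl _) fl.
Qed.

Lemma comp_bilin (M N P P' : lmodType C) (op : M -> N -> P) (k : P -> P') :
  bilin op -> slinear id k -> bilin (fun m n => k (op m n)).
Proof.
move=> [hr hl] kl; split=> [m|n]; first exact: slinear_comp kl (hr _).
exact: slinear_comp kl (hl _).
Qed.

Lemma bilinD (M N P : lmodType C) (op op' : M -> N -> P) :
  bilin op -> bilin op' -> bilin (fun m n => op m n + op' m n).
Proof.
move=> [hr hl] [hr' hl']; split=> [m|n]; split=> [x y|k x].
- by rewrite (hr _).1 (hr' _).1 addrACA.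
- by rewrite (hr _).2 (hr' _).2 scalerDr.
- by rewrite (hl _).1 (hl' _).1 addrACA.
- by rewrite (hl _).2 (hl' _).2 scalerDr.
Qed.

Lemma cmul_cmap (M N P M' N' : lmodType C) (op : M -> N -> P)
    (f : M' -> M) (g : N' -> N) (x : ctens A M') (y : ctens A N') :
  bilin op -> slinear id f -> slinear id g ->
  cmul op (cmap idfun f x) (cmap idfun g y) = cmul (fun m n => op (f m) (g n)) x y.
Proof.
move=> opb fl gl; have il := @slinear_id A.
have fgb := bilin_comp opb fl gl.
have cb := bilin_comp (cmul_bilin opb) (cmap_slinear il fl) (cmap_slinear il gl).
apply: (ctens_ext2 cb (cmul_bilin fgb)) => a m a' n.
by rewrite (cmapE il fl) (cmapE il gl) !cmulE.
Qed.

Lemma cmap_cmul (M N P P' : lmodType C) (op : M -> N -> P) (k : P -> P')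
    (x : ctens A M) (y : ctens A N) :
  bilin op -> slinear id k ->
  cmap idfun k (cmul op x y) = cmul (fun m n => k (op m n)) x y.
Proof.
move=> opb kl; have il := @slinear_id A; have kb := comp_bilin opb kl.
apply: (ctens_ext2 (comp_bilin (cmul_bilin opb) (cmap_slinear il kl))
  (cmul_bilin kb)) => a m a' n.
by rewrite !cmulE // (cmapE il kl).
Qed.

Lemma cmulD (M N P : lmodType C) (op op' : M -> N -> P)
    (x : ctens A M) (y : ctens A N) : bilin op -> bilin op' ->
  cmul (fun m n => op m n + op' m n) x y = cmul op x y + cmul op' x y.
Proof.
move=> opb opb'; have Db := bilinD opb opb'.
apply: (ctens_ext2 (cmul_bilin Db)
  (bilinD (cmul_bilin opb) (cmul_bilin opb'))) => a m a' n.
by rewrite !cmulE // ((cpure_bilin _ _).1 _).1.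
Qed.

Lemma cmulN (M N P : lmodType C) (op : M -> N -> P)
    (x : ctens A M) (y : ctens A N) : bilin op ->
  cmul (fun m n => - op m n) x y = - cmul op x y.
Proof.
move=> opb; have Nl (V : lmodType C) : slinear id (fun v : V => - v).
  by split=> [u v|k v]; [exact: opprD|rewrite scalerN].
apply: (ctens_ext2 (cmul_bilin (comp_bilin opb (Nl _)))
  (comp_bilin (cmul_bilin opb) (Nl _))) => a m a' n.
rewrite !cmulE //; last exact: comp_bilin.
by rewrite -scaleN1r ((cpure_bilin _ _).1 _).2 scaleN1r.
Qed.

(** Products along composable operations reassociate because the product of A does. *)
Lemma cmulA (M N P Q T U : lmodType C) (op1 : Q -> P -> T) (op2 : M -> N -> Q)
    (op3 : M -> U -> T) (op4 : N -> P -> U) :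
  bilin op1 -> bilin op2 -> bilin op3 -> bilin op4 ->
  (forall m n p, op1 (op2 m n) p = op3 m (op4 n p)) ->
  forall (x : ctens A M) (y : ctens A N) (z : ctens A P),
  cmul op1 (cmul op2 x y) z = cmul op3 x (cmul op4 y z).
Proof.
move=> b1 b2 b3 b4 e x y z.
have [r1 l1] := cmul_bilin b1; have [r2 l2] := cmul_bilin b2.
have [r3 l3] := cmul_bilin b3; have [r4 l4] := cmul_bilin b4.
move: z; apply: ctens_ext => [z z'|z z'|c p].
- exact: (r1 _).1.
- by rewrite (r4 _).1 (r3 _).1.
move: x y; apply: ctens_ext2 => [||a m b n].
- exact: comp_bilin (cmul_bilin b2) (l1 _).
- exact: bilin_comp (cmul_bilin b3) (@slinear_id _) (l4 _).
- by rewrite !cmulE // mulrA e.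
Qed.

End Mul.

(** The star of A reverses products, so the operation op' on the conjugate side
takes its arguments in the opposite order. *)
Lemma cmul_star (A : starAlgType C) (M N P M' N' P' : lmodType C)
    (op : M -> N -> P) (op' : N' -> M' -> P')
    (f : M -> M') (g : N -> N') (k : P -> P') :
  bilin op -> bilin op' -> slinear Num.conj f -> slinear Num.conj g ->
  slinear Num.conj k -> (forall m n, k (op m n) = op' (g n) (f m)) ->
  forall (x : ctens A M) (y : ctens A N),
  cmap star k (cmul op x y) = cmul op' (cmap star g y) (cmap star f x).
Proof.
move=> b b' fl gl kl e x y.
have sl : slinear Num.conj (@star C A) by split; [exact: starD|exact: starZ].
have [r l] := cmul_bilin A b; have [r' l'] := cmul_bilin A b'.
move: x; apply: ctens_ext => [x x'|x x'|a m].
- by rewrite (l _).1 (cmap_slinear sl kl).1.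
- by rewrite (cmap_slinear sl fl).1 (r' _).1.
move: y; apply: ctens_ext => [y y'|y y'|a' n].
- by rewrite (r _).1 (cmap_slinear sl kl).1.
- by rewrite (cmap_slinear sl gl).1 (l' _).1.
by rewrite cmulE // !(cmapE sl) // cmulE // starM e.
Qed.

End ComplexTensorTheory.

(** * Coactions of a Hopf star-algebra and the antipode *)

Section HopfCoactions.
Variables (C : numClosedFieldType) (A : hopfStarAlgType C).

Lemma star_slinear (D : starAlgType C) : slinear Num.conj (@star C D).
Proof. by split; [exact: starD|exact: starZ]. Qed.

Lemma comul_slinear : slinear id (@comul C A).
Proof. exact: linear_slinear comul_linear. Qed.

Lemma counit_slinear : slinear id (@counit C A : A -> C^o).
Proof. exact: linear_slinear counit_linear. Qed.

Lemma antipode_slinear : slinear id (@antipode C A).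
Proof. exact: linear_slinear antipode_linear. Qed.

Lemma conj_slinear_comp (M N P : lmodType C) (f : N -> P) (g : M -> N) :
  slinear Num.conj f -> slinear Num.conj g -> slinear id (f \o g).
Proof.
by move=> fl gl; have [D Z] := slinear_comp fl gl; split=> // k x; rewrite Z /= conjCK.
Qed.

Definition lmul (V : lmodType C) (a : A) (x : ctens A V) : ctens A V :=
  cmap (fun a' => a * a') idfun x.
Definition rmul (V : lmodType C) (a : A) (x : ctens A V) : ctens A V :=
  cmap (fun a' => a' * a) idfun x.

Lemma lmul_bilin V : bilin (@lmul V).
Proof.
have [mr ml] := mul_bilin A; have [cr cl] := cpure_bilin A V.
split=> [a|x]; first exact: cmap_slinear (mr a) (@slinear_id _ V).
apply: tlift_param => a v; exact: slinear_comp (cl _) (ml a).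
Qed.

Lemma rmul_bilin V : bilin (@rmul V).
Proof.
have [mr ml] := mul_bilin A; have [cr cl] := cpure_bilin A V.
split=> [a|x]; first exact: cmap_slinear (ml a) (@slinear_id _ V).
apply: tlift_param => a v; exact: slinear_comp (cl _) (mr a).
Qed.

Lemma lmul_cpure (V : lmodType C) (a a' : A) (v : V) : lmul a (cpure a' v) = cpure (a * a') v.
Proof.
by rewrite /lmul (cmapE (s := id)) //; apply: (mul_bilin A).1.
Qed.

Lemma rmul_cpure (V : lmodType C) (a a' : A) (v : V) : rmul a (cpure a' v) = cpure (a' * a) v.
Proof.
by rewrite /rmul (cmapE (s := id)) //; apply: (mul_bilin A).2.
Qed.

Lemma lmulM (V : lmodType C) a b (x : ctens A V) : lmul a (lmul b x) = lmul (a * b) x.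
Proof.
have [lr _] := lmul_bilin V.
move: x; apply: ctens_ext => [x y|x y|a' v].
- by rewrite !(lr _).1.
- by rewrite (lr _).1.
- by rewrite !lmul_cpure mulrA.
Qed.

(** Separates the first factor of the product, so that coassociativity can be
applied to it. *)
Lemma cmul_lmul (M N P : lmodType C) (op : M -> N -> P)
    (x : ctens A M) (y : ctens A N) : bilin op ->
  cmul op x y = tlift (fun a m => lmul a (cmap idfun (op m) y)) x.
Proof.
move=> [opr _]; apply: eq_tlift => a m; rewrite /lmul (cmap_comp (s := id) (s' := id)) //.
exact: (mul_bilin A).1.
Qed.

(** Coassociativity in Sweedler form:
F (m_(-2)) (m_(-1)) (m_(0)) does not depend on how the two coefficients are split
off. *)
Lemma tlift_coassoc (M V : lmodType C) (delta : M -> ctens A M)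
    (F : A -> A -> M -> V) : left_coaction delta ->
  (forall a, bilin (F a)) -> (forall b m, slinear id (fun a => F a b m)) ->
  forall m,
  tlift (fun a m0 => tlift (F a) (delta m0)) (delta m) =
  tlift (fun a m0 => tlift (fun b b' => F b b' m0) (comul a)) (delta m).
Proof.
move=> [dl dassoc _] Fb Fl m; have dsl := linear_slinear dl.
have idl N := @slinear_id C N.
have Lb : bilin (fun a (t : ctens A M) => tlift (F a) t).
  split=> [a|t]; first exact: clift_slinear (Fb a).
  by apply: tlift_param => b m0; apply: Fl.
have Fb1 m0 : bilin (fun b b' => F b b' m0).
  by split=> [b|b']; [apply: (Fb b).2|apply: Fl].
have Rb : bilin (fun a m0 => tlift (fun b b' => F b b' m0) (comul a)).
  split=> [a|m0]; first by apply: tlift_param => b b'; apply: (Fb b).1.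
  exact: slinear_comp (clift_slinear (Fb1 m0)) comul_slinear.
have pb (m0 : M) : bilin (fun b b' : A => cpure b (cpure b' m0)).
  have [pr pl] := cpure_bilin A (ctens A M); have [pr' pl'] := cpure_bilin A M.
  by split=> [b|b']; [exact: slinear_comp (pr b) (pl' m0)|exact: pl].
have pb' : bilin (fun (t : ctens A A) (m0 : M) =>
    tlift (fun b b' => cpure b (cpure b' m0)) t).
  split=> [t|m0]; last exact: clift_slinear (pb m0).
  apply: tlift_param => b b'.
  exact: slinear_comp ((cpure_bilin A (ctens A M)).1 b) ((cpure_bilin A M).1 b').
have [LD _] := clift_slinear Lb.
transitivity (tlift (fun a (t : ctens A M) => tlift (F a) t) 
    (cmap idfun delta (delta m))).
  move: (delta m); apply: ctens_ext => [x y|x y|a m0].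
  - by apply: (clift_slinear (F := fun a m0 => _) _).1; apply: bilin_comp Lb _ dsl.
  - by rewrite (cmap_slinear (idl A) dsl).1 LD.
  - rewrite (cmapE (idl A) dsl) (cliftE Lb) /= cliftE //.
    exact: bilin_comp Lb (idl A) dsl.
rewrite -dassoc; move: (delta m); apply: ctens_ext => [x y|x y|a m0].
- by rewrite (cmap_slinear comul_slinear (idl M)).1 /cassoc (clift_slinear pb').1 LD.
- exact: (clift_slinear Rb).1.
- rewrite (cmapE comul_slinear (idl M)) /cassoc (cliftE pb') (cliftE Rb).
  rewrite -(tlift_fun _ _ (clift_slinear Lb)).
  by apply: eq_tlift => b b'; rewrite (cliftE Lb) cliftE.
Qed.

Lemma tlift_counit (M V : lmodType C) (delta : M -> ctens A M) (f : M -> V) :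
  left_coaction delta -> slinear id f ->
  forall m, tlift (fun a m0 => counit a *: f m0) (delta m) = f m.
Proof.
move=> [_ _ dcounit] fl m; rewrite -[in RHS](dcounit m) -(tlift_fun _ _ fl).
by apply: eq_tlift => a m0; rewrite fl.2.
Qed.

(** This is the inverse of the antipode, i.e. the antipode of the co-opposite Hopf
algebra. *)
Definition skew_antipode (a : A) : A := star (antipode (star a)).

Lemma skew_antipode_slinear : slinear id skew_antipode.
Proof.
apply: (conj_slinear_comp (star_slinear A) (g := antipode \o star)).
have [D Z] := slinear_comp antipode_slinear (star_slinear A).
by split=> // k x; rewrite Z.
Qed.

(** The star of the left antipode identity for star a. *)
Lemma skew_antipodeP (a : A) :
  tlift (fun b b' => b' * skew_antipode b) (comul a) = (counit a)%:A.
Proof.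
have [mr ml] := mul_bilin A.
have Fb : bilin (fun b b' : A => antipode b * b').
  by split=> [b|b']; [exact: mr|exact: slinear_comp (ml b') antipode_slinear].
have Gb : bilin (fun b b' : A => b' * skew_antipode b).
  by split=> [b|b']; [exact: ml|exact: slinear_comp (mr b') skew_antipode_slinear].
have sl := star_slinear A.
have e (x : ctens A A) : tlift (fun b b' => b' * skew_antipode b) x =
    star (tlift (fun b b' => antipode b * b') (cmap star star x)).
  move: x; apply: ctens_ext => [x y|x y|b b'].
  - exact: (clift_slinear Gb).1.
  - by rewrite (cmap_slinear sl sl).1 (clift_slinear Fb).1 starD.
  - by rewrite (cliftE Gb) (cmapE sl sl) (cliftE Fb) starM starK.
by rewrite e -comul_star antipodel counit_star starZ star1 conjCK.
Qed.

(** The hypothesis is colinearity of n |-> op _ n as a map into a dual comodule, whose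
coaction twists by the antipode of m_(-1).  Multiplying by m_(-2) on the left
cancels that twist. *)
Lemma colinear_pairing (M N P : lmodType C) (dM : M -> ctens A M)
    (dN : N -> ctens A N) (dP : P -> ctens A P) (op : M -> N -> P) :
  left_coaction dM -> slinear id dP -> bilin op ->
  (forall m n, cmap idfun (op m) (dN n) =
     tlift (fun a m0 => lmul (antipode a) (dP (op m0 n))) (dM m)) ->
  forall m n, dP (op m n) = cmul op (dM m) (dN n).
Proof.
move=> dMP dPl opb h m n; have [opr opl] := opb.
have [lr ll] := lmul_bilin P.
pose G m0 := dP (op m0 n); have Gl : slinear id G by apply: slinear_comp dPl (opl n).
pose F a b m0 := lmul a (lmul (antipode b) (G m0)).
transitivity (tlift (fun a m0 => tlift (F a) (dM m0)) (dM m)); last first.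
  rewrite cmul_lmul //; apply: eq_tlift => a m0.
  by rewrite h -(tlift_fun _ _ (lr a)).
have F1 a : bilin (F a).
  split=> [b|m0]; apply: slinear_comp (lr a) _.
    exact: slinear_comp (lr _) Gl.
  exact: slinear_comp (ll _) antipode_slinear.
rewrite (tlift_coassoc dMP F1); last by move=> b m0; apply: ll.
rewrite -/(G m) -(tlift_counit dMP Gl); apply: eq_tlift => a m0.
rewrite -[counit a *: _](_ : lmul (counit a)%:A (G m0) = _); last first.
  by rewrite (ll _).2 /lmul cmap_id // => x; rewrite mul1r.
rewrite -antipoder -(tlift_fun _ _ (ll (G m0))).
by apply: eq_tlift => b b'; rewrite /F lmulM.
Qed.

(** With y = a (x) t, the right-hand side is
a n_(-1) S^-1(n_(-2)) (x) op t n_(0), and n_(-1) S^-1(n_(-2)) collapses to the counit. *)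
Lemma pairing_untwist (T N V : lmodType C) (dN : N -> ctens A N)
    (op : T -> N -> V) : left_coaction dN -> bilin op ->
  forall y n, cmap idfun (op^~ n) y =
    tlift (fun b n0 => rmul (skew_antipode b) (cmul op y (dN n0))) (dN n).
Proof.
move=> dNP opb y n; have [opr opl] := opb.
have [rr rl] := rmul_bilin V; have [mr ml] := mul_bilin A.
have [cr cl] := cmul_bilin A opb; have [pr pl] := cpure_bilin A V.
have [dNl _ _] := dNP; have dNs := linear_slinear dNl.
move: y; apply: ctens_ext => [x y|x y|a t].
- by apply: (cmap_slinear (s := id) _ (opl n)).1.
- apply: (tlift_param (dN n) (F := fun y b n0 => rmul (skew_antipode b)
    (cmul op y (dN n0))) _).1 => b n0; exact: slinear_comp (rr _) (cl _).
rewrite (cmapE (slinear_id A) (opl n)) /=.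
pose F b b' n0 := cpure (a * (b' * skew_antipode b)) (op t n0).
have F1 b : bilin (F b).
  split=> [b'|n0]; first exact: slinear_comp (pr _) (opr t).
  exact: slinear_comp (pl _) (slinear_comp (mr a) (ml _)).
have F2 b' n0 : slinear id (fun b => F b b' n0).
  exact: slinear_comp (pl _) (slinear_comp (mr a) 
    (slinear_comp (mr b') skew_antipode_slinear)).
transitivity (tlift (fun b n0 => tlift (F b) (dN n0)) (dN n)); last first.
  apply: eq_tlift => b n0; rewrite /cmul cliftE; last exact: cmul_outer.
  rewrite -(tlift_fun _ _ (rr _)); apply: eq_tlift => b' n1.
  by rewrite rmul_cpure -mulrA.
rewrite (tlift_coassoc dNP F1 F2).
transitivity (tlift (fun b n0 => counit b *: cpure a (op t n0)) (dN n)).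
  by symmetry; apply: tlift_counit dNP (slinear_comp (pr a) (opr t)) n.
apply: eq_tlift => b n0.
have [_ plZ] := pl (op t n0).
rewrite -[counit b *: _]plZ -[a in counit b *: a]mulr1 scalerAr -skew_antipodeP.
by symmetry; apply: (tlift_fun _ _ (slinear_comp (pl (op t n0)) (mr a))).
Qed.

(** The twisted products y_(-1) n_(-1) (x) op y_(0) n_(0), taken over all n,
determine the untwisted ones. *)
Lemma pairing_cancel (T N V : lmodType C) (dN : N -> ctens A N)
    (op : T -> N -> V) y y' : left_coaction dN -> bilin op ->
  (forall n, cmul op y (dN n) = cmul op y' (dN n)) ->
  forall n, cmap idfun (op^~ n) y = cmap idfun (op^~ n) y'.
Proof.
move=> dNP opb e n; rewrite !(pairing_untwist dNP opb).
by apply: eq_tlift => b n0; rewrite e.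
Qed.

End HopfCoactions.

(** * Comodules: associators, conjugates and graded parts *)

Section Associator.
Variable C : numClosedFieldType.

Fact cassoc_inner (M N P : lmodType C) (p : P) :
  bilin (fun (m : M) (n : N) => cpure m (cpure n p)).
Proof.
have [pr pl] := cpure_bilin M (ctens N P); have [pr' pl'] := cpure_bilin N P.
by split=> [m|n]; [exact: slinear_comp (pr m) (pl' p)|exact: pl].
Qed.

Fact cassoc_outer (M N P : lmodType C) : bilin (fun (t : ctens M N) (p : P) =>
  tlift (fun m n => cpure m (cpure n p)) t).
Proof.
split=> [t|p]; last exact: clift_slinear (cassoc_inner M N p).
apply: tlift_param => m n.
exact: slinear_comp ((cpure_bilin _ _).1 m) ((cpure_bilin _ _).1 n).
Qed.

Lemma cassocE (M N P : lmodType C) (m : M) (n : N) (p : P) :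
  cassoc (cpure (cpure m n) p) = cpure m (cpure n p).
Proof. by rewrite /cassoc (cliftE (cassoc_outer M N P)) (cliftE (cassoc_inner _ _ _)). Qed.

Lemma cassoc_slinear (M N P : lmodType C) : slinear id (@cassoc C M N P).
Proof. exact: clift_slinear (cassoc_outer M N P). Qed.

Lemma cassoc_natural s (M N P M' N' P' : lmodType C)
    (f : M -> M') (g : N -> N') (h : P -> P') :
  slinear s f -> slinear s g -> slinear s h ->
  forall t, cassoc (cmap (cmap f g) h t) = cmap f (cmap g h) (cassoc t).
Proof.
move=> fl gl hl.
have fgl := cmap_slinear fl gl; have ghl := cmap_slinear gl hl.
have [aD _] := cassoc_slinear M N P; have [aD' _] := cassoc_slinear M' N' P'.
have [lD _] := cmap_slinear fgl hl; have [rD _] := cmap_slinear fl ghl.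
apply: ctens_ext => [x y|x y|t p]; [by rewrite lD aD'|by rewrite aD rD|].
have [pr pl] := cpure_bilin (ctens M N) P; have [_ pl'] := cpure_bilin (ctens M' N') P'.
rewrite (cmapE fgl hl); move: t; apply: ctens_ext => [x y|x y|m n].
- by rewrite fgl.1 (pl' _).1 aD'.
- by rewrite (pl _).1 aD rD.
- by rewrite (cmapE fl gl) !cassocE (cmapE fl ghl) (cmapE gl hl).
Qed.

End Associator.

Section Pullback.
Variables (C : numClosedFieldType) (A : hopfStarAlgType C).

(** A coaction may be checked after embedding M in a comodule N.  The twist sigma of
the Hopf algebra lets one statement serve both a graded part included in its
ambient module (sigma the identity) and the conjugate of a module, identified with
that module as a set (sigma the star). *)
Lemma coaction_pullback (s s' : C -> C) (sigma tau : A -> A) (M N : lmodType C)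
    (f : M -> N) (g : N -> M) (dM : M -> ctens A M) (dN : N -> ctens A N) :
  (forall k, s' (s k) = k) ->
  slinear s sigma -> slinear s' tau -> cancel sigma tau ->
  slinear s f -> slinear s' g -> cancel f g ->
  (forall a, comul (sigma a) = cmap sigma sigma (comul a)) ->
  (forall a, counit (sigma a) = s (counit a)) ->
  left_coaction dN -> (forall m, dN (f m) = cmap sigma f (dM m)) ->
  left_coaction dM.
Proof.
move=> sK sl tl sgK fl gl fK scomul scounit [dNl dNassoc dNcounit] dE.
have il V := @slinear_id C V; have dNs := linear_slinear dNl.
have sfl := cmap_slinear sl fl; have tgl := cmap_slinear tl gl.
have sfK (x : ctens A M) : cmap tau g (cmap sigma f x) = x.
  by rewrite (cmap_comp tl gl sl fl) cmap_id.
have dME m : dM m = cmap tau g (dN (f m)) by rewrite dE sfK.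
have dMs : slinear id dM.
  by split=> [x y|k x]; rewrite !dME ?fl.1 ?fl.2 ?dNs.1 ?dNs.2 ?tgl.1 ?tgl.2 /= ?sK.
split=> [k x y|m|m]; first by rewrite dMs.1 dMs.2.
  have PhiK : cancel (cmap sigma (cmap sigma f) : ctens A (ctens A M) -> _)
      (cmap tau (cmap tau g)).
    by move=> x; rewrite (cmap_comp tl tgl sl sfl) cmap_id.
  apply: (can_inj PhiK); rewrite -(cassoc_natural sl sl fl).
  rewrite (cmap_comp (cmap_slinear sl sl) fl (comul_slinear A) (il M)).
  rewrite (cmap_comp sl sfl (il A) dMs).
  transitivity (cassoc (cmap comul idfun (cmap sigma f (dM m)))).
    rewrite (cmap_comp (comul_slinear A) (il N) sl fl); congr cassoc.
    by apply: eq_cmap => // a; rewrite /= scomul.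
  rewrite -dE dNassoc dE (cmap_comp (il A) dNs sl fl).
  by apply: eq_cmap => // x; rewrite /= dE.
apply: (can_inj fK); rewrite -(tlift_fun _ _ fl) -[RHS]dNcounit dE.
have epsb (V : lmodType C) : bilin (fun (a : A) (v : V) => counit a *: v).
  split=> [a|v]; first exact: slinear_scale.
  by split=> [a b|k a]; rewrite ?(counit_slinear A).1 ?(counit_slinear A).2
    ?scalerDl ?scalerA.
have seps : balanced (fun (a : A) (k : C) => k *: a) (fun (k : C) (m : M) => k *: m)
    (fun a m => f (counit a *: m)).
  have [br bl] := epsb M; split=> [a b x|a x y|a k x].
  - by rewrite (bl _).1 fl.1.
  - by rewrite (br _).1 fl.1.
  - by congr f; rewrite (bl _).2 (br _).2.
move: (dM m); apply: ctens_ext => [x y|x y|a x].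
- exact: tliftD seps x y.
- by rewrite sfl.1 (clift_slinear (epsb N)).1.
- rewrite (cmapE sl fl) (cliftE (epsb N)) [LHS](tliftE seps) scounit fl.2 //.
Qed.

Lemma cj_slinear (D : starAlgType C) (M : bimodType D) : slinear Num.conj (@cj C D M).
Proof. by split=> // k x; rewrite [RHS]/( _ *: _) /= /cj_scale conjCK. Qed.

Lemma uncj_slinear (D : starAlgType C) (M : bimodType D) : slinear Num.conj (@uncj C D M).
Proof. by []. Qed.

Lemma conjugate_coactE (D : starAlgType C) (M : bimodType D) (delta : M -> ctens A M) m :
  delta (uncj m) = cmap star (@uncj C D M) (conjugate_coact delta m).
Proof.
rewrite /conjugate_coact (cmap_comp (star_slinear A) (@uncj_slinear D M)
  (star_slinear A) (@cj_slinear D M)).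
by rewrite cmap_id // => a; rewrite /= starK.
Qed.

Lemma conjugate_coact_slinear (D : starAlgType C) (M : bimodType D)
    (delta : M -> ctens A M) :
  slinear id delta -> slinear id (conjugate_coact delta).
Proof.
move=> [dD dZ]; have cl := cmap_slinear (star_slinear A) (@cj_slinear D M).
apply: (conj_slinear_comp cl (g := fun x => delta (uncj x))).
by split=> [x y|k x]; [exact: dD|exact: dZ].
Qed.

Lemma conjugate_coactP (D : starAlgType C) (M : bimodType D) (delta : M -> ctens A M) :
  left_coaction delta -> left_coaction (conjugate_coact delta).
Proof.
move=> dP; apply: (coaction_pullback (s := Num.conj) (s' := Num.conj)
  (sigma := star) (tau := star) (f := @uncj C D M) (g := @cj C D M)) dP _.
- exact: conjCK.
- exact: star_slinear.
- exact: star_slinear.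
- exact: starK.
- exact: uncj_slinear.
- exact: cj_slinear.
- by [].
- exact: comul_star.
- exact: counit_star.
- exact: conjugate_coactE.
Qed.

End Pullback.

Section GradedParts.
Variables (C : numClosedFieldType) (V : lmodType C) (I : eqType) (G : grading V I).

Lemma proj_slinear i : slinear id (proj G i).
Proof. by split=> [x y|k x]; rewrite ?linearD ?linearZ. Qed.

Lemma part_val_slinear i : slinear id (@part_val C V I G i).
Proof. by []. Qed.

Lemma to_part_slinear i : slinear id (to_part G i).
Proof. by split=> [x y|k x]; apply: val_inj; rewrite /= ?linearD ?linearZ. Qed.

(** Since V is the sum of its parts, the projection is determined by its values on
homogeneous elements; every commutation of a projection with another operation
below is an instance. *)
Lemma proj_universal (W : zmodType) (f g : V -> W) i :
  {morph f : x y / x + y} -> {morph g : x y / x + y} ->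
  {in homogeneous G i, g =1 f} ->
  (forall j x, j != i -> x \in homogeneous G j -> g x = 0) ->
  forall x, g x = f (proj G i x).
Proof.
move=> fD gD gf g0 x.
have f00 : f 0 = 0 by apply: (@addrI _ (f 0)); rewrite -fD !addr0.
have g00 : g 0 = 0 by apply: (@addrI _ (g 0)); rewrite -gD !addr0.
have [r [_ ->]] := proj_sum G x.
rewrite (big_morph g gD g00) linear_sum (big_morph f fD f00).
apply: eq_bigr => j _; have [->|ne] := eqVneq j i.
  by rewrite projK gf // proj_homogeneous.
by rewrite (g0 j) ?proj_homogeneous // proj_orth // eq_sym.
Qed.

Variables (A : hopfStarAlgType C) (delta : V -> ctens A V).
Hypothesis deltaP : left_coaction delta.

(** The coaction of a part is a corestriction; being a subcomodule says that nothing
is lost. *)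
Lemma part_coactE i : subcomodule G i delta ->
  forall x : part G i, delta x = cmap idfun (@part_val C V I G i) (part_coact delta x).
Proof.
move=> sub x; have [t et] := sub x; rewrite /part_coact et.
have il := @slinear_id C A; have vl := part_val_slinear i.
have tl := to_part_slinear i.
rewrite (cmap_comp il tl il vl) (cmap_comp il vl il (slinear_comp tl vl)).
by apply: eq_cmap => // y; rewrite /= (eqP (part_homogeneous y)).
Qed.

Lemma part_coactP i : subcomodule G i delta -> left_coaction (part_coact (G := G) (i := i) delta).
Proof.
move=> sub; apply: (coaction_pullback (s := id) (s' := id)
  (sigma := idfun) (tau := idfun) (f := @part_val C V I G i) (g := to_part G i)) deltaP _ => //.
- exact: to_part_slinear.
- exact: to_part_val.
- by move=> a; rewrite cmap_id.
- exact: part_coactE.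
Qed.

Lemma proj_colinear i : (forall j, subcomodule G j delta) ->
  forall x, delta (proj G i x) = cmap idfun (proj G i) (delta x).
Proof.
move=> sub x; have [dl _ _] := deltaP; have ds := linear_slinear dl.
have il := @slinear_id C A; have pl := cmap_slinear il (proj_slinear i).
symmetry; apply: (proj_universal (f := delta)
  (g := cmap idfun (proj G i) \o delta)) => [||y hy|j y ne hy].
- exact: ds.1.
- by move=> y z /=; rewrite ds.1 pl.1.
- rewrite /= -[y]/(part_val (Part hy)) (part_coactE (sub i)).
  rewrite (cmap_comp il (proj_slinear i) il (part_val_slinear i)).
  by apply: eq_cmap => // z; apply/eqP/part_homogeneous.
- rewrite /= -[y]/(part_val (Part hy)) (part_coactE (sub j)).
  rewrite (cmap_comp il (proj_slinear i) il (part_val_slinear j)).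
  rewrite /cmap /tlift big1 // => -[a z] _ /=.
  rewrite (proj_neq (part_homogeneous z)) 1?eq_sym //.
  exact: slinear0 ((cpure_bilin A V).1 a).
Qed.

Lemma to_part_coact i : (forall j, subcomodule G j delta) ->
  forall x, part_coact delta (to_part G i x) = cmap idfun (to_part G i) (delta x).
Proof.
move=> sub x; rewrite /part_coact /= (proj_colinear i sub).
have il := @slinear_id C A.
rewrite (cmap_comp il (to_part_slinear i) il (proj_slinear i)).
by apply: eq_cmap => // y; apply: val_inj; apply: projK.
Qed.

End GradedParts.

(** * Balanced tensor products of covariant bimodules *)

Section BalancedTensors.
Variables (C : numClosedFieldType) (B : algType C) (M N : bimodType B).

(** A scalar crosses the balanced tensor product as the element k%:A of B. *)
Lemma bpure_bilin : bilin (@bpure C B M N).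
Proof.
have [hl hr hb] := bpure_balanced M N.
split=> [m|n]; split=> [x y|k x]; rewrite /= ?hl ?hr //.
  rewrite -[k *: x](_ : lact k%:A x = _); last by rewrite lactZ lact1.
  by rewrite -hb ractZ ract1; symmetry; apply: btens_scaleE.
by symmetry; apply: btens_scaleE.
Qed.

Lemma btens_ext (V : zmodType) (f g : btens M N -> V) :
  {morph f : x y / x + y} -> {morph g : x y / x + y} ->
  (forall m n, f (bpure m n) = g (bpure m n)) -> f =1 g.
Proof. exact: tens_ext. Qed.

Section Lift.
Variables (s : C -> C) (V : lmodType C) (F : M -> N -> V).
Hypothesis Fb : balanced (@ract C B M) (@lact C B N) F.
Hypothesis FZ : forall k m n, F (k *: m) n = s k *: F m n.

Lemma bliftE m n : tlift F (bpure m n) = F m n.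
Proof. exact: tliftE Fb m n. Qed.

Lemma blift_slinear : slinear s (tlift F : btens M N -> V).
Proof.
have lD : {morph (tlift F : btens M N -> V) : x y / x + y} by apply: tliftD Fb.
split=> // k; apply: btens_ext => [x y|x y|m n] /=.
- by rewrite scalerDr lD.
- by rewrite lD scalerDr.
- by rewrite -((bpure_bilin).2 n).2 !bliftE FZ.
Qed.

End Lift.

End BalancedTensors.

Lemma cmul_cmapl (C : numClosedFieldType) (A : algType C) (M N P M' : lmodType C)
    (op : M -> N -> P) (f : M' -> M) (x : ctens A M') (y : ctens A N) :
  bilin op -> slinear id f ->
  cmul op (cmap idfun f x) y = cmul (fun m n => op (f m) n) x y.
Proof.
move=> opb fl; rewrite -(cmul_cmap _ _ opb fl (@slinear_id C N)).
by rewrite [cmap _ idfun y]cmap_id.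
Qed.

Lemma cmul_cmapr (C : numClosedFieldType) (A : algType C) (M N P N' : lmodType C)
    (op : M -> N -> P) (g : N' -> N) (x : ctens A M) (y : ctens A N') :
  bilin op -> slinear id g ->
  cmul op x (cmap idfun g y) = cmul (fun m n => op m (g n)) x y.
Proof.
move=> opb gl; rewrite -(cmul_cmap _ _ opb (@slinear_id C M) gl).
by rewrite [cmap _ idfun x]cmap_id.
Qed.

Section BtensCoaction.
Variables (C : numClosedFieldType) (A : hopfStarAlgType C) (B : comoduleStarAlgType A).

Lemma lact_bilin (M : bimodType B) : bilin (@lact C B M).
Proof.
split=> [b|m]; split=> [x y|k x] /=; first exact: lactDr; first exact: lactZr.
  exact: lactDl.
exact: lactZ.
Qed.

Lemma ract_bilin (M : bimodType B) : bilin (@ract C B M).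
Proof.
split=> [b|m]; split=> [x y|k x] /=; first exact: ractDr; first exact: ractZ.
  exact: ractDl.
exact: ractZl.
Qed.

Variables (M N : bimodType B) (dM : M -> ctens A M) (dN : N -> ctens A N).
Hypotheses (dMl : slinear id dM) (dNl : slinear id dN).
Hypothesis dM_ract : forall m b, dM (ract m b) = cmul (@ract C B M) (dM m) (coact b).
Hypothesis dN_lact : forall b n, dN (lact b n) = cmul (@lact C B N) (coact b) (dN n).

Lemma btens_coact_balanced : balanced (@ract C B M) (@lact C B N)
  (fun m n => cmul (@bpure C B M N) (dM m) (dN n)).
Proof.
have bb := bpure_bilin M N; have [cr cl] := cmul_bilin A bb.
have [_ _ hb] := bpure_balanced M N.
split=> [m m' n|m n n'|m b n].
- by rewrite dMl.1 (cl _).1.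
- by rewrite dNl.1 (cr _).1.
- rewrite dM_ract dN_lact; apply: cmulA => //; [exact: ract_bilin|exact: lact_bilin].
Qed.

Lemma btens_coactE m n :
  btens_coact dM dN (bpure m n) = cmul (@bpure C B M N) (dM m) (dN n).
Proof. exact: bliftE btens_coact_balanced m n. Qed.

Lemma btens_coact_slinear : slinear id (btens_coact dM dN).
Proof.
apply: blift_slinear btens_coact_balanced _ => k m n.
by rewrite dMl.2 ((cmul_bilin A (bpure_bilin M N)).2 _).2.
Qed.

End BtensCoaction.

Section FormsPieces.
Variables (C : numClosedFieldType) (A : hopfStarAlgType C).
Variables (B : comoduleStarAlgType A) (X : starCalculus B) (cov : covariantCalculus X).
Local Notation Om := (forms X).
Local Notation delta := (fcoact cov).

Lemma fcoact_slinear : slinear id delta.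
Proof. by have [dl _ _] := fcoactP cov; apply: linear_slinear. Qed.

Lemma iota_slinear : slinear id (Defs.iota X).
Proof. by split=> [x y|k x]; rewrite ?linearD ?linearZ. Qed.

Lemma diff_slinear : slinear id (diff X).
Proof. by split=> [x y|k x]; rewrite ?linearD ?linearZ. Qed.

Lemma coact_slinear : slinear id (@coact C A B).
Proof. by have [dl _ _] := @coactP C A B; apply: linear_slinear. Qed.

Lemma fstar_slinear : slinear Num.conj (@fstar C B X).
Proof. by split; [exact: fstarD|exact: fstarZ]. Qed.

Section Piece.
Variables (I : eqType) (G : grading Om I) (i : I).
Variable closed : bimodule_part (Defs.iota X) G i.
Hypothesis sub : subcomodule G i delta.
Local Notation P := (piece closed).

(** Pieces of the total algebra of forms are treated for an arbitrary grading, so that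
the forms of degree 1 and those of bidegree (p, q) share the proofs. *)
Definition piece_coact : P -> ctens A P := part_coact delta.

Lemma piece_val_slinear : slinear id (@piece_val _ _ _ _ _ _ _ closed).
Proof. by []. Qed.

Definition to_piece (x : Om) : P := to_part G i x.

Lemma to_piece_slinear : slinear id to_piece.
Proof. exact: to_part_slinear. Qed.

Lemma piece_coactE (x : P) :
  delta (piece_val x) = cmap idfun (@piece_val _ _ _ _ _ _ _ closed) (piece_coact x).
Proof. exact: (part_coactE sub). Qed.

Lemma piece_coactP : left_coaction piece_coact.
Proof. exact: (part_coactP (fcoactP cov) sub). Qed.

Lemma piece_coact_slinear : slinear id piece_coact.
Proof. by have [dl _ _] := piece_coactP; apply: linear_slinear. Qed.

Lemma piece_coact_val (x : P) : piece_coact x = cmap idfun to_piece (delta (piece_val x)).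
Proof. by []. Qed.

Lemma to_pieceK (x : P) : to_piece (piece_val x) = x.
Proof. exact: to_part_val. Qed.

(** Multiplicativity of the coaction on all forms, restricted to one part. *)
Lemma piece_coact_ract (x : P) b :
  piece_coact (ract x b) = cmul (@ract C B P) (piece_coact x) (coact b).
Proof.
have mb := mul_bilin Om.
rewrite piece_coact_val [piece_val _]/(piece_val x * Defs.iota X b) fcoactM.
rewrite piece_coactE fcoact_iota (cmul_cmap _ _ mb piece_val_slinear iota_slinear).
rewrite (cmap_cmul _ _ (bilin_comp mb piece_val_slinear iota_slinear) to_piece_slinear).
by apply: eq_cmul => m c; apply: to_pieceK (ract m c).
Qed.

Lemma piece_coact_lact b (x : P) :
  piece_coact (lact b x) = cmul (@lact C B P) (coact b) (piece_coact x).
Proof.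
have mb := mul_bilin Om.
rewrite piece_coact_val [piece_val _]/(Defs.iota X b * piece_val x) fcoactM.
rewrite piece_coactE fcoact_iota (cmul_cmap _ _ mb iota_slinear piece_val_slinear).
rewrite (cmap_cmul _ _ (bilin_comp mb iota_slinear piece_val_slinear) to_piece_slinear).
by apply: eq_cmul => c m; apply: to_pieceK (lact c m).
Qed.

End Piece.

End FormsPieces.

(** * Pairing form-valued tensors with the metric *)

Lemma additive_tlift (R : Type) (M N : zmodType) (ra : M -> R -> M) (la : R -> N -> N)
    (V V' : zmodType) (f : V -> V') (F : M -> N -> V) (x : tens ra la) :
  {morph f : x y / x + y} -> f (tlift F x) = tlift (fun m n => f (F m n)) x.
Proof.
move=> fD; apply: (big_morph f fD); by apply: (@addrI _ (f 0)); rewrite -fD !addr0.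
Qed.

Section Pairing.
Variables (C : numClosedFieldType) (A : hopfStarAlgType C).
Variables (B : comoduleStarAlgType A) (X : starCalculus B) (cov : covariantCalculus X).
Local Notation Om := (forms X).
Local Notation delta := (fcoact cov).
Local Notation iota := (Defs.iota X).

Variables (E : bimodType B) (dE : E -> ctens A E) (h : hermitianMetric E).
Local Notation cE := (conjugate E).
Local Notation cdE := (conjugate_coact dE).

Lemma pairing_bilin : bilin (pairing h).
Proof.
have hl := linear_slinear (@metric_linear _ _ _ h).
split=> [e|x]; rewrite /pairing.
  by split=> [x y|k x]; rewrite /= ?hl.1 ?hl.2.
by split=> [e f|k e]; rewrite /= ?lhomD ?lhomZ.
Qed.

Lemma pairing_lact b e x : pairing h (lact b e) x = b * pairing h e x.
Proof. by rewrite /pairing -[lact b e]addr0 lhomP lhom0 addr0. Qed.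

Lemma pairing_colinear : left_coaction dE -> covariant_metric dE h ->
  forall e x, coact (pairing h e x) = cmul (pairing h) (dE e) (cdE x).
Proof.
move=> dEP [dH [dHE hcol]]; have [pr pl] := pairing_bilin.
have hl := linear_slinear (@metric_linear _ _ _ h).
apply: (colinear_pairing dEP (coact_slinear B) pairing_bilin).
move=> e x; rewrite -[RHS]dHE hcol.
have evl : slinear id (fun g : leftHom E => g e) by [].
by rewrite (cmap_comp (@slinear_id _ A) evl (@slinear_id _ A) hl).
Qed.

(** One-forms enter twice, as all of Omega^1 (for nabla) and as Omega^(0,1) (for D).
The record collects what the pairing lemmas use of either, v being the inclusion
into all forms. *)
Record form_module (W : bimodType B) (v : W -> Om) (dW : W -> ctens A W) := {
  fm_lin : slinear id v;
  fm_ract : forall w b, v (ract w b) = v w * iota b;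
  fm_degree : forall w, v w \in homogeneous (degree X) 1;
  fm_coact_lin : slinear id dW;
  fm_coact_ract : forall w b, dW (ract w b) = cmul (@ract C B W) (dW w) (coact b);
  fm_coact : forall w, delta (v w) = cmap idfun v (dW w)
}.

Section FormModule.
Variables (W : bimodType B) (v : W -> Om) (dW : W -> ctens A W).
Hypothesis fm : form_module v dW.
Hypothesis dEP : left_coaction dE.
Hypothesis dE_lact : forall b e, dE (lact b e) = cmul (@lact C B E) (coact b) (dE e).
Hypothesis dpair : forall e x, coact (pairing h e x) = cmul (pairing h) (dE e) (cdE x).

Definition pair_form (t : btens W E) (x : cE) : Om :=
  tlift (fun w e => v w * iota (pairing h e x)) t.

(** The value is antilinear in the tensor, hence linear in the conjugate module. *)
Definition pair_conj (e : E) (s : conjugate (btens W E)) : Om :=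
  tlift (fun w f => iota (pairing h e (cj f)) * fstar (v w)) (uncj s).

Fact iota_pairing_bilin : bilin (fun e x => iota (pairing h e x)).
Proof. exact: comp_bilin pairing_bilin (iota_slinear X). Qed.

Fact pair_form_balanced (x : cE) : balanced (@ract C B W) (@lact C B E)
  (fun w e => v w * iota (pairing h e x)).
Proof.
have [mr ml] := mul_bilin Om; have [_ pl] := iota_pairing_bilin.
split=> [w w' e|w e e'|w b e].
- by rewrite (fm_lin fm).1 (ml _).1.
- by rewrite (pl _).1 (mr _).1.
- by rewrite (fm_ract fm) pairing_lact rmorphM mulrA.
Qed.

Lemma pair_formE w e x : pair_form (bpure w e) x = v w * iota (pairing h e x).
Proof. exact: bliftE (pair_form_balanced x) w e. Qed.

Lemma pair_form_bilin : bilin pair_form.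
Proof.
have [mr ml] := mul_bilin Om; have [pr pl] := iota_pairing_bilin.
split=> [t|x].
  apply: tlift_param => w e; exact: slinear_comp (mr _) (pr e).
apply: blift_slinear (pair_form_balanced x) _ => k w e.
by rewrite (fm_lin fm).2 (ml _).2.
Qed.

Lemma pair_form_colinear t x :
  delta (pair_form t x) = cmul pair_form (btens_coact dW dE t) (cdE x).
Proof.
have [pfr pfl] := pair_form_bilin; have mb := mul_bilin Om.
have [cr cl] := cmul_bilin A pair_form_bilin.
have [dEl _ _] := dEP; have dEs := linear_slinear dEl.
have ds := fcoact_slinear cov; have vl := fm_lin fm.
have pbD := btens_coact_slinear (fm_coact_lin fm) dEs (fm_coact_ract fm) dE_lact.
move: t; apply: btens_ext => [s t|s t|w e].
- by rewrite (pfl _).1 ds.1.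
- by rewrite pbD.1 (cl _).1.
rewrite pair_formE fcoactM (fm_coact fm) fcoact_iota dpair.
rewrite (btens_coactE (fm_coact_lin fm) dEs (fm_coact_ract fm) dE_lact).
rewrite (cmap_cmul _ _ pairing_bilin (iota_slinear X)).
rewrite (cmul_cmapl _ _ mb vl); symmetry.
apply: cmulA (pair_form_bilin) _ _ _ _ _ _ _.
- exact: bpure_bilin.
- exact: bilin_comp mb vl (@slinear_id _ _).
- exact: iota_pairing_bilin.
- exact: pair_formE.
Qed.

(** Star moves b from the right of w to the left of its star; there the pairing absorbs
it, since the conjugate of b f is the conjugate of f multiplied by b^* on the right. *)
Fact pair_conj_balanced (e : E) : balanced (@ract C B W) (@lact C B E)
  (fun w f => iota (pairing h e (cj f)) * fstar (v w)).
Proof.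
have [mr ml] := mul_bilin Om; have [pr _] := iota_pairing_bilin.
split=> [w w' f|w f f'|w b f].
- by rewrite (fm_lin fm).1 fstarD (mr _).1.
- by rewrite (pr e).1 (ml _).1.
- rewrite (fm_ract fm) (fstarM (fm_degree fm w) (iota_degree X b)) muln0 expr0 scale1r.
  rewrite fstar_iota mulrA; congr (_ * _); rewrite -rmorphM; congr (iota _).
  rewrite /pairing -[cj (lact b f)](_ : ract (cj f) (star b) = _); last first.
    by rewrite /ract /= /cj_ract starK.
  by rewrite metric_ract.
Qed.

Lemma pair_conjE w f e : pair_conj e (cj (bpure w f)) =
  iota (pairing h e (cj f)) * fstar (v w).
Proof. exact: bliftE (pair_conj_balanced e) w f. Qed.

Lemma pair_conj_bilin : bilin pair_conj.
Proof.
have [mr ml] := mul_bilin Om; have [pr pl] := iota_pairing_bilin.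
split=> [e|s]; last first.
  apply: tlift_param => w f; exact: slinear_comp (ml _) (pl _).
apply: conj_slinear_comp _ (@uncj_slinear C B _).
apply: blift_slinear (pair_conj_balanced e) _ => k w f.
by rewrite (fm_lin fm).2 fstarZ (mr _).2.
Qed.

(** The two stars, on w and on f, reverse the order of the coefficients in A, which is
the order in which the pairing puts the starred form. *)
Lemma pair_conj_colinear e s : delta (pair_conj e s) =
  cmul pair_conj (dE e) (conjugate_coact (btens_coact dW dE) s).
Proof.
have [pfr pfl] := pair_conj_bilin; have mb := mul_bilin Om.
have [cr cl] := cmul_bilin A pair_conj_bilin.
have [dEl _ _] := dEP; have dEs := linear_slinear dEl.
have ds := fcoact_slinear cov; have vl := fm_lin fm.
have pbD := btens_coact_slinear (fm_coact_lin fm) dEs (fm_coact_ract fm) dE_lact.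
have sl := star_slinear A; have bb := bpure_bilin W E.
have cjl (M : bimodType B) := @cj_slinear C B M.
have ucjl (M : bimodType B) := @uncj_slinear C B M.
rewrite -[s]/(cj (uncj s)); move: (uncj s); apply: btens_ext => [t t'|t t'|w f].
- by rewrite [cj _](cjl _).1 (pfr _).1 ds.1.
- by rewrite [cj _](cjl _).1 (conjugate_coact_slinear pbD).1 (cr _).1.
rewrite pair_conjE fcoactM fcoact_iota dpair fcoact_star (fm_coact fm).
rewrite (cmap_cmul _ _ pairing_bilin (iota_slinear X)).
rewrite /conjugate_coact /=.
rewrite (btens_coactE (fm_coact_lin fm) dEs (fm_coact_ract fm) dE_lact).
(* The product of the conjugated coactions, with the factors exchanged by star. *)
pose op' (y : cE) (z : conjugate W) : conjugate (btens W E) := cj (bpure (uncj z) (uncj y)).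
have op'b : bilin op'.
  split=> [y|z].
    apply: conj_slinear_comp (cjl _) _; have [bD bZ] := bb.2 (uncj y).
    by split=> [a b|k a]; [exact: bD|exact: bZ].
  apply: conj_slinear_comp (cjl _) _; have [bD bZ] := bb.1 (uncj z).
  by split=> [a b|k a]; [exact: bD|exact: bZ].
rewrite (cmul_star bb op'b (cjl _) (cjl _) (cjl _)) //.
pose g (z : conjugate W) := fstar (v (uncj z)).
have gl : slinear id g.
  apply: conj_slinear_comp (fstar_slinear X) _; have [vD vZ] := vl.
  by split=> [a b|k a]; [exact: vD|exact: vZ].
have -> : cmap star (@fstar _ _ X) (cmap idfun v (dW w)) =
    cmap idfun g (cmap star (@cj _ _ W) (dW w)).
  rewrite (cmap_comp sl (fstar_slinear X) (@slinear_id _ A) vl).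
  by rewrite (cmap_comp (@slinear_id _ A) gl sl (cjl _)).
rewrite (cmul_cmapr _ _ mb gl).
apply: cmulA (bilin_comp mb (@slinear_id _ _) gl) _ _ op'b _ _ _ _.
- exact: iota_pairing_bilin.
- exact: pair_conj_bilin.
- by move=> m n p; rewrite pair_conjE.
Qed.

End FormModule.

End Pairing.

(** * Dual bases and the bigrading *)

Section DualBasis.
Variables (C : numClosedFieldType) (B : algType C).

Definition dual_basis (M : bimodType B) n (e : 'I_n -> M) (phi : 'I_n -> leftHom M) :
    Prop :=
  forall m, m = \sum_i lact (phi i m) (e i).

(** Projectivity splits the surjection from a free module given by the generators; the
forms phi i are the coordinates of the splitting. *)
Lemma dual_basis_exists (M : bimodType B) :
  finitely_generated M -> projective M ->
  exists n (e : 'I_n -> M) (phi : 'I_n -> leftHom M), dual_basis e phi.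
Proof.
move=> [n [e gen]] proj.
pose g (b : 'rV[B]_n) : left_module M := \sum_i b 0 i *: e i.
have glin : linear g.
  move=> k b c; rewrite /g scaler_sumr -big_split; apply: eq_bigr => i _ /=.
  by rewrite !mxE scalerDl scalerA.
pose gL : {linear 'rV[B]_n -> left_module M} :=
  HB.pack g (GRing.isLinear.Build _ _ _ _ g glin).
pose idL : {linear left_module M -> left_module M} := idfun.
have gsurj m : exists b, gL b = m.
  have [b ->] := gen m; exists (\row_i b i).
  by apply: eq_bigr => i _; rewrite mxE.
have [s gs] := proj _ _ gL idL gsurj.
have phiP i : (fun m : M => (s m : 'rV[B]_n) 0 i) \in @left_linear_pred C B M.
  apply/asboolP => b m m'.
  by rewrite -[lact b m + m']/(b *: (m : left_module M) + m') linearP !mxE.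
exists n, e, (fun i => LeftHom (phiP i)) => m.
by rewrite -[LHS]gs.
Qed.

Lemma dual_basis_retract (M N : bimodType B) (i : N -> M) (r : M -> N) :
  (forall b x y, i (lact b x + y) = lact b (i x) + i y) ->
  (forall b x y, r (lact b x + y) = lact b (r x) + r y) -> cancel i r ->
  forall n (e : 'I_n -> M) (phi : 'I_n -> leftHom M), dual_basis e phi ->
  exists (e' : 'I_n -> N) (phi' : 'I_n -> leftHom N), dual_basis e' phi'.
Proof.
move=> il rl iK n e phi de.
have phiP j : (fun x : N => phi j (i x)) \in @left_linear_pred C B N.
  by apply/asboolP => b x y; rewrite il lhomP.
exists (r \o e), (fun j => LeftHom (phiP j)) => x; rewrite -{1}[x]iK {1}[i x]de.
have r0 : r 0 = 0.
  have := rl 1 0 0; rewrite lact1 addr0 => /eqP; rewrite -subr_eq subrr.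
  by rewrite lact1 => /eqP.
have rD y z : r (y + z) = r y + r z by have := rl 1 y z; rewrite !lact1.
rewrite (big_morph r rD r0); apply: eq_bigr => j _ /=.
by rewrite -[lact _ _ in LHS]addr0 rl r0 addr0.
Qed.

End DualBasis.

Section ComplexStructure.
Variables (C : numClosedFieldType) (B : starAlgType C).
Variables (X : starCalculus B) (S : complexStructure X).
Local Notation Om := (forms X).
Local Notation G := (bidegree S).
Local Notation iota := (Defs.iota X).

Lemma proj_iotal pq b x : proj G pq (iota b * x) = iota b * proj G pq x.
Proof.
case: pq => p q.
apply: (proj_universal (f := fun x => iota b * x) (g := fun x => proj G (p, q) (iota b * x))).
- by move=> y z; rewrite mulrDr.
- by move=> y z; rewrite mulrDr linearD.
- by move=> y hy; apply/eqP; exact: (bform_closed b hy).1.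
- by move=> [j k] y ne hy; rewrite (proj_neq (bform_closed b hy).1) // eq_sym.
Qed.

Lemma proj_iotar pq b x : proj G pq (x * iota b) = proj G pq x * iota b.
Proof.
case: pq => p q.
apply: (proj_universal (f := fun x => x * iota b) (g := fun x => proj G (p, q) (x * iota b))).
- by move=> y z; rewrite mulrDl.
- by move=> y z; rewrite mulrDl linearD.
- by move=> y hy; apply/eqP; exact: (bform_closed b hy).2.
- by move=> [j k] y ne hy; rewrite (proj_neq (bform_closed b hy).2) // eq_sym.
Qed.

Lemma proj_fstar p q x : proj G (q, p) (fstar x) = fstar (proj G (p, q) x).
Proof.
apply: (proj_universal (f := @fstar _ _ X) (g := fun x => proj G (q, p) (fstar x))).
- exact: fstarD.
- by move=> y z; rewrite fstarD linearD.
- by move=> y hy; apply/eqP; exact: bidegree_fstar hy.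
- move=> [j k] y ne hy; rewrite (proj_neq (bidegree_fstar hy)) //.
  by apply: contraNneq ne => -[-> ->].
Qed.

Lemma degree1_split x : x \in homogeneous (degree X) 1 ->
  x = proj G (0, 1)%N x + proj G (1, 0)%N x.
Proof.
by move=> /eqP e; rewrite -[LHS]e (bidegree_degree S) big_ord_recl big_ord1.
Qed.

Lemma bform01_degree (w : bform S 0 1) : bform_val w \in homogeneous (degree X) 1.
Proof. exact: bidegree_homogeneous (part_homogeneous w). Qed.

Definition to_dform1 (w : bform S 1 0) : dform X 1 :=
  Part (bidegree_homogeneous (part_homogeneous w)).

Definition pi10 (w : dform X 1) : bform S 1 0 := to_bform S 1 0 (dform_val w).

(** The projection of one-forms onto bidegree (1,0) is left B-linear, so Omega^(1,0) is
a retract of Omega^1. *)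
Lemma Omega10_dual_basis :
  finitely_generated (dform X 1) -> projective (dform X 1) ->
  exists n (e : 'I_n -> bform S 1 0) (phi : 'I_n -> leftHom (bform S 1 0)),
    dual_basis e phi.
Proof.
move=> fg pr; have [n [e [phi de]]] := dual_basis_exists fg pr.
have il b (x y : bform S 1 0) :
    to_dform1 (lact b x + y) = lact b (to_dform1 x) + to_dform1 y.
  exact: val_inj.
have rl b x y : pi10 (lact b x + y) = lact b (pi10 x) + pi10 y.
  by apply: val_inj; rewrite /= linearD; congr (_ + _); apply: proj_iotal.
have irK : cancel to_dform1 pi10.
  by move=> x; apply: val_inj; apply/eqP/part_homogeneous.
have [e' [phi' de']] := dual_basis_retract il rl irK de.
by exists n, e', phi'.
Qed.

End ComplexStructure.

(** * Covariance of the Chern connection *)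

Section Chern.
Variables (C : numClosedFieldType) (A : hopfStarAlgType C).
Variables (B : comoduleStarAlgType A) (X : starCalculus B).
Variables (S : complexStructure X) (cov : covariantCalculus X).
Hypothesis Scov : covariant_complex S cov.
Local Notation Om := (forms X).
Local Notation delta := (fcoact cov).
Local Notation iota := (Defs.iota X).
Local Notation G := (bidegree S).
Local Notation E := (bform S 1 0).
Local Notation dE := (bform_coact S cov 1 0).
Local Notation dW := (bform_coact S cov 0 1).
Local Notation d1 := (@dform_coact _ _ _ _ (fcoact cov) 1).
Local Notation val1 := (@dform_val _ _ X 1).
Local Notation val01 := (@bform_val _ _ X S 0 1).

Lemma bidegree_subcomodule pq : subcomodule G pq delta.
Proof. by case: pq => p q; apply: Scov. Qed.

Lemma dform_form_module : form_module cov val1 d1.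
Proof.
have sub := @fcoact_degree _ _ _ _ cov 1; split.
- exact: piece_val_slinear.
- by [].
- exact: part_homogeneous.
- exact: (piece_coact_slinear (@dform_closed _ _ X 1) sub).
- exact: (piece_coact_ract (closed := @dform_closed _ _ X 1) sub).
- exact: (piece_coactE (closed := @dform_closed _ _ X 1) sub).
Qed.

Lemma bform01_form_module : form_module cov val01 dW.
Proof.
have sub := @bidegree_subcomodule (0, 1)%N; split.
- exact: piece_val_slinear.
- by [].
- exact: bform01_degree.
- exact: (piece_coact_slinear (@bform_closed _ _ _ S 0 1) sub).
- exact: (piece_coact_ract (closed := @bform_closed _ _ _ S 0 1) sub).
- exact: (piece_coactE (closed := @bform_closed _ _ _ S 0 1) sub).
Qed.

Lemma bform_coactP p q : left_coaction (bform_coact S cov p q).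
Proof. exact: (piece_coactP (@bform_closed _ _ _ S p q) (@bidegree_subcomodule _)). Qed.

Lemma bform_coact_slinear p q : slinear id (bform_coact S cov p q).
Proof. by have [dl _ _] := bform_coactP p q; apply: linear_slinear. Qed.

Lemma bform_coact_lact p q b (e : bform S p q) :
  bform_coact S cov p q (lact b e) =
  cmul (@lact C B (bform S p q)) (coact b) (bform_coact S cov p q e).
Proof.
exact: (piece_coact_lact (closed := @bform_closed _ _ _ S p q)
  (@bidegree_subcomodule _)).
Qed.

Lemma bform_coact_ract p q b (e : bform S p q) :
  bform_coact S cov p q (ract e b) =
  cmul (@ract C B (bform S p q)) (bform_coact S cov p q e) (coact b).
Proof.
exact: (piece_coact_ract (closed := @bform_closed _ _ _ S p q)
  (@bidegree_subcomodule _)).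
Qed.

Lemma bform_coactE p q (e : bform S p q) :
  delta (bform_val e) = cmap idfun (@bform_val _ _ X S p q) (bform_coact S cov p q e).
Proof. exact: (piece_coactE (closed := @bform_closed _ _ _ S p q) (@bidegree_subcomodule _)). Qed.

Lemma to_bform_coact p q x :
  bform_coact S cov p q (to_bform S p q x) = cmap idfun (@to_bform _ _ X S p q) (delta x).
Proof. exact: (to_part_coact (fcoactP cov) (p, q) (@bidegree_subcomodule) x). Qed.

Lemma bform_val_slinear p q : slinear id (@bform_val _ _ X S p q).
Proof. by []. Qed.

Lemma to_bform_slinear p q : slinear id (@to_bform _ _ X S p q).
Proof. exact: to_part_slinear. Qed.

Lemma to_bformK p q (w : bform S p q) : to_bform S p q (bform_val w) = w.
Proof. exact: to_part_val. Qed.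

Lemma wedge_slinear p q : slinear id (@wedge_antihol_hol _ _ _ S p q).
Proof. by split=> [s t|k t]; [exact: wedgeD|exact: wedgeZ]. Qed.

(** The coaction on forms is multiplicative, and the wedge map is the product of forms. *)
Lemma wedge_colinear p q :
  colinear (btens_coact (bform_coact S cov 0 q) (bform_coact S cov p 0))
    (bform_coact S cov p q) (@wedge_antihol_hol _ _ _ S p q).
Proof.
move=> t; have mb := mul_bilin Om; have il := @slinear_id C A.
have wl := wedge_slinear p q; have bb := bpure_bilin (bform S 0 q) (bform S p 0).
have dl q' p' := bform_coact_slinear q' p'.
have cwl := cmap_slinear il wl.
have bl := btens_coact_slinear (dl 0 q) (dl p 0)
  (fun m b => bform_coact_ract b m) (@bform_coact_lact p 0).
move: t; apply: btens_ext => [s t|s t|x y].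
- by rewrite wl.1 (dl _ _).1.
- by rewrite bl.1 cwl.1.
rewrite (btens_coactE (dl 0 q) (dl p 0) (fun m b => bform_coact_ract b m)
  (@bform_coact_lact p 0)) (cmap_cmul _ _ bb wl).
rewrite -[wedge_antihol_hol S p q _]to_bformK to_bform_coact wedgeE fcoactM !bform_coactE.
rewrite (cmul_cmap _ _ mb (bform_val_slinear 0 q) (bform_val_slinear p 0)).
rewrite (cmap_cmul _ _ (bilin_comp mb (bform_val_slinear _ _) (bform_val_slinear _ _))
  (to_bform_slinear p q)).
by apply: eq_cmul => m n; rewrite -wedgeE to_bformK.
Qed.

Variable fact : factorizable S.
Variable theta : bform S 1 1 -> btens (bform S 0 1) E.
Hypothesis thetaK : cancel theta (@wedge_antihol_hol _ _ _ S 1 1).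
Hypothesis wedgeK : cancel (@wedge_antihol_hol _ _ _ S 1 1) theta.

Local Notation D := (Omega10_holomorphic fact thetaK).
Local Notation dWE := (btens_coact dW dE).

Lemma theta_slinear : slinear id theta.
Proof.
have [wD wZ] := wedge_slinear 1 1.
by split=> [x y|k x]; apply: (can_inj wedgeK); rewrite ?wD ?wZ !thetaK.
Qed.

(** The inverse of a bijective colinear map is colinear. *)
Lemma theta_colinear : colinear (bform_coact S cov 1 1) dWE theta.
Proof.
move=> y; have il := @slinear_id C A; have wl := wedge_slinear 1 1.
rewrite -[in RHS](thetaK y) wedge_colinear (cmap_comp il theta_slinear il wl).
by rewrite cmap_id.
Qed.

Lemma D_slinear : slinear id D.
Proof. exact: linear_slinear (delbarE_linear D). Qed.

Lemma D_colinear : colinear dE dWE D.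
Proof.
move=> e; have il := @slinear_id C A.
have dfl := diff_slinear X; have vl := bform_val_slinear 1 0.
have tl := to_bform_slinear 1 2.
have -> : D e = theta (to_bform S 1 1 (diff X (bform_val e))) by [].
rewrite theta_colinear to_bform_coact fcoact_diff bform_coactE.
rewrite (cmap_comp il dfl il vl) (cmap_comp il (to_bform_slinear 1 1) il (slinear_comp dfl vl)).
by rewrite (cmap_comp il theta_slinear il
  (slinear_comp (to_bform_slinear 1 1) (slinear_comp dfl vl))).
Qed.

Variable h : hermitianMetric E.
Hypothesis hcov : covariant_metric dE h.
Local Notation cE := (conjugate E).
Local Notation cdE := (conjugate_coact dE).

Definition cD (x : cE) : conjugate (btens (bform S 0 1) E) := cj (D (uncj x)).

Lemma cD_slinear : slinear id cD.
Proof.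
apply: conj_slinear_comp (@cj_slinear C B _) _; have [DD DZ] := D_slinear.
by split=> [x y|k x]; [exact: DD|exact: DZ].
Qed.

Lemma cD_colinear : colinear cdE (conjugate_coact dWE) cD.
Proof.
move=> x; have sl := star_slinear A; have il := @slinear_id C A.
have cjl (M : bimodType B) := @cj_slinear C B M.
rewrite (cmap_comp il cD_slinear sl (cjl _)).
rewrite {1}/conjugate_coact [uncj (cD x)]/(D (uncj x)) D_colinear.
by rewrite (cmap_comp sl (cjl _) il D_slinear).
Qed.

(** The one-form that the pairing of nabla e with x has to be; it involves D and the
metric only. *)
Definition chern_pairing (e : E) (x : cE) : Om :=
  pair_form h val01 (D e) x +
  (proj G (1, 0)%N (diff X (iota (pairing h e x))) - pair_conj h val01 e (cD x)).

Lemma dpairing e x : coact (pairing h e x) = cmul (pairing h) (dE e) (cdE x).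
Proof. exact: pairing_colinear (bform_coactP 1 0) hcov e x. Qed.

Lemma chern_pairing_colinear e x :
  delta (chern_pairing e x) = cmul chern_pairing (dE e) (cdE x).
Proof.
have fm := bform01_form_module; have ds := fcoact_slinear cov.
have il := @slinear_id C A.
have dEP := bform_coactP 1 0; have dEl := @bform_coact_lact 1 0.
have pfb := pair_form_bilin h fm; have pcb := pair_conj_bilin h fm.
have pb := iota_pairing_bilin X h.
have b1 := bilin_comp pfb D_slinear (@slinear_id C cE).
have b3 := bilin_comp pcb (@slinear_id C E) cD_slinear.
have dl := slinear_comp (proj_slinear G (1, 0)%N) (diff_slinear X).
have b2 := comp_bilin pb dl.
have nl : slinear id (fun w : Om => - w).
  by split=> [u w|k w]; [exact: opprD|rewrite scalerN].
have dN w : delta (- w) = - delta w by rewrite -scaleN1r ds.2 scaleN1r.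
have b3' := comp_bilin b3 nl.
rewrite (cmulD _ _ b1 (bilinD b2 b3')) (cmulD _ _ b2 b3') (cmulN _ _ b3).
rewrite !ds.1 dN (pair_form_colinear fm dEP dEl dpairing).
rewrite (pair_conj_colinear fm dEP dEl dpairing) D_colinear cD_colinear.
rewrite (cmul_cmapl _ _ pfb D_slinear) (cmul_cmapr _ _ pcb cD_slinear).
congr (_ + (_ - _)).
rewrite (proj_colinear (fcoactP cov) _ (@bidegree_subcomodule)) fcoact_diff fcoact_iota dpairing.
rewrite (cmap_cmul _ _ (pairing_bilin h) (iota_slinear X)).
rewrite (cmap_comp il (proj_slinear G _) il (diff_slinear X)).
by rewrite (cmap_cmul _ _ pb dl).
Qed.

Section Connection.
Variable nabla : E -> btens (dform X 1) E.
Hypothesis chern : chern_connection D h nabla.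

Lemma pair_right_val t x : dform_val (pair_right h t x) = pair_form h val1 t x.
Proof.
exact: (additive_tlift (f := val1) (fun w e => ract w (pairing h e x)) t (fun _ _ => erefl)).
Qed.

Lemma pair_left_val e (t : btens (dform X 1) E) :
  dform_val (pair_left h e (tlift (fun w f => bpure (cj f) (fstar1 w)) t)) =
  pair_conj h val1 e (cj t).
Proof.
have [mr ml] := mul_bilin Om; have [pr pl] := iota_pairing_bilin X h.
have bal : balanced (@ract C B cE) (@lact C B (dform X 1))
    (fun x w => iota (pairing h e x) * val1 w).
  split=> [x y w|x w w'|x b w].
  - by rewrite (pr e).1 (ml _).1.
  - exact: (mr _).1.
  - by rewrite /pairing metric_ract [X in iota X]/(_ * _) rmorphM -mulrA.
rewrite /pair_left (additive_tlift (f := val1)) //.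
rewrite (additive_tlift _ _ (tliftD bal)).
by apply: eq_tlift => w f; rewrite (tliftE bal).
Qed.

Lemma proj01_pair_form (t : btens (dform X 1) E) x : proj G (0, 1)%N (pair_form h val1 t x) =
  pair_form h val01 (bmap (@pi01 _ _ _ S) idfun t) x.
Proof.
have fm := bform01_form_module.
rewrite /bmap (additive_tlift (f := fun t => pair_form h val01 t x)); last first.
  exact: ((pair_form_bilin h fm).2 x).1.
rewrite {1}/pair_form (additive_tlift (f := proj G (0, 1)%N)); last exact: linearD.
apply: eq_tlift => w e.
by rewrite proj_iotar (pair_formE h fm).
Qed.

(** Star exchanges bidegrees (1,0) and (0,1). *)
Lemma proj10_pair_conj e (t : btens (dform X 1) E) : proj G (1, 0)%N (pair_conj h val1 e (cj t)) =
  pair_conj h val01 e (cj (bmap (@pi01 _ _ _ S) idfun t)).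
Proof.
have fm := bform01_form_module.
rewrite /bmap (additive_tlift (f := fun t => pair_conj h val01 e (cj t))); last first.
  exact: ((pair_conj_bilin h fm).1 e).1.
rewrite {1}/pair_conj (additive_tlift (f := proj G (1, 0)%N)); last exact: linearD.
apply: eq_tlift => w f.
by rewrite proj_iotal proj_fstar (pair_conjE h fm).
Qed.

(** The (0,1)-part of the pairing is given by the condition that nabla lifts D; the
(1,0)-part by compatibility with the metric, in which the conjugate term only sees
the (0,1)-part of nabla, again D. *)
Lemma pair_nabla e x : pair_form h val1 (nabla e) x = chern_pairing e x.
Proof.
have [_ compat nabla01] := chern.
have split1 : val1 (pair_right h (nabla e) x) =
    proj G (0, 1)%N (val1 (pair_right h (nabla e) x)) +
    proj G (1, 0)%N (val1 (pair_right h (nabla e) x)).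
  exact: degree1_split (part_homogeneous _).
rewrite -pair_right_val split1 pair_right_val proj01_pair_form.
rewrite (_ : bmap _ _ _ = D e) ?nabla01 //; congr (_ + _).
have -> : diff X (iota (pairing h e x)) =
    pair_form h val1 (nabla e) x + pair_conj h val1 e (cj (nabla (uncj x))).
  by rewrite -pair_right_val -pair_left_val; apply: congr1 val1 _ _ (compat e (uncj x)).
by rewrite linearD /= proj10_pair_conj nabla01 addrK.
Qed.

(** Covariance of nabla is an equality in A (x) (Omega^1 (x)_B E).  Both sides have the
same pairings with every x, and a dual basis reconstructs a tensor from finitely
many of these. *)
Lemma chern_connection_covariant n (e : 'I_n -> E) (phi : 'I_n -> leftHom E) :
  dual_basis e phi -> covariant_connection cov dE nabla.
Proof.
move=> de m; have [[nl _] _ _] := chern; have nabl := linear_slinear nl.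
have fm := dform_form_module; have pfb := pair_form_bilin h fm.
have dEP := bform_coactP 1 0; have dEl := @bform_coact_lact 1 0.
have il := @slinear_id C A.
have [hinv hK hinvK] := metric_bij h.
have pr x : cmap idfun (fun t => pair_form h val1 t x) (btens_coact d1 dE (nabla m)) =
    cmap idfun (fun t => pair_form h val1 t x) (cmap idfun nabla (dE m)).
  apply: (pairing_cancel (conjugate_coactP dEP) pfb) => y.
  rewrite -(pair_form_colinear fm dEP dEl dpairing) pair_nabla chern_pairing_colinear.
  rewrite (cmul_cmapl _ _ pfb nabl).
  by apply: eq_cmul => e' y'; rewrite pair_nabla.
pose rec i (w : Om) : btens (dform X 1) E := bpure (to_part (degree X) 1 w : dform X 1) (e i).
have recl i : slinear id (rec i).
  have [bD bZ] := (bpure_bilin (dform X 1) E).2 (e i).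
  have [tD tZ] := to_part_slinear (degree X) 1%N.
  by split=> [u w|k w]; rewrite /rec ?tD ?tZ; [exact: bD|exact: bZ].
(* hinv (phi i) is the element g_i of the conjugate module with phi i = <-, g_i>. *)
have recK t : t = \sum_i rec i (pair_form h val1 t (hinv (phi i))).
  have [hl hr hb] := bpure_balanced (dform X 1) E.
  move: t; apply: btens_ext => [//|s t|w f].
    rewrite -big_split; apply: eq_bigr => i _.
    by rewrite (pfb.2 _).1 (recl i).1.
  rewrite {1}[f]de (slinear_sum _ _ ((bpure_bilin _ _).1 w)); apply: eq_bigr => i _.
  rewrite -hb (pair_formE h fm) /pairing hinvK /rec; congr bpure.
  by rewrite -[LHS]to_part_val.
have recA (y : ctens A (btens (dform X 1) E)) : y = \sum_i cmap idfun (rec i)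
    (cmap idfun (fun t => pair_form h val1 t (hinv (phi i))) y).
  have cl i := cmap_slinear il (recl i).
  have cl' i := cmap_slinear il (pfb.2 (hinv (phi i))).
  move: y; apply: ctens_ext => [//|y z|a t].
    rewrite -big_split; apply: eq_bigr => i _.
    by rewrite (cl' i).1 (cl i).1.
  rewrite {1}[t]recK (slinear_sum _ _ ((cpure_bilin _ _).1 a)); apply: eq_bigr => i _.
  by rewrite (cmapE il (pfb.2 _)) (cmapE il (recl i)).
rewrite [LHS]recA [RHS]recA; apply: eq_bigr => i _; congr cmap; exact: pr.
Qed.

End Connection.
End Chern.

Theorem corollary5p6 (R : realType)
    (A : hopfStarAlgType (complex R)) (B : comoduleStarAlgType A)
    (X : starCalculus B) (S : complexStructure X) (cov : covariantCalculus X)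
    (S_covariant : covariant_complex S cov)
    (S_factorizable : factorizable S)
    (Omega1_fg : finitely_generated (dform X 1))
    (Omega1_projective : projective (dform X 1))
    (theta : bform S 1 1 -> btens (bform S 0 1) (bform S 1 0))
    (thetaK : cancel theta (wedge_antihol_hol S 1 1))
    (wedgeK : cancel (wedge_antihol_hol S 1 1) theta)
    (h : hermitianMetric (bform S 1 0))
    (h_covariant : covariant_metric (bform_coact S cov 1 0) h)
    (nabla : bform S 1 0 -> btens (dform X 1) (bform S 1 0))
    (nabla_chern :
      chern_connection (Omega10_holomorphic S_factorizable thetaK) h nabla) :
  covariant_connection cov (bform_coact S cov 1 0) nabla.
Proof.
have [n [e [phi de]]] := Omega10_dual_basis S Omega1_fg Omega1_projective.
exact: (chern_connection_covariant S_covariant wedgeK h_covariant nabla_chern de).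
Qed.
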